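(* Assume (H1), (H2) (with its exponent $q>0$) and (H3) hold. Then for every $T>0$ there is a constant $C>0$ such that the truncated Euler–Maruyama scheme $(z_i^{\triangle})$ satisfies $$\sup_{0<\triangle\le 1}\ \sup_{0\le i\triangle\le T}\mathbb{E}|z_i^{\triangle}|^{q}\le C,$$ where the outer supremum is over the admissible stepsizes $\triangle=\tau/N\in(0,1]$, $N$ a positive integer, and the inner one over integers $i$ with $0\le i\triangle\le T$.
   Context: Setting. $|\cdot|$ is the Euclidean norm on $\mathbb{R}^d$ and the Hilbert–Schmidt norm on $\mathbb{R}^{d\times m}$; $a\vee b=\max(a,b)$, $a\wedge b=\min(a,b)$; $\mathbb{R}_+=[0,\infty)$. Let $\tau>0$, $f:\mathbb{R}^d\times\mathbb{R}^d\to\mathbb{R}^d$, $g:\mathbb{R}^d\times\mathbb{R}^d\to\mathbb{R}^{d\times m}$, and let $W$ be an $m$-dimensional Brownian motion on a complete filtered probability space $(\Omega,\mathcal{F},(\mathcal{F}_t),\mathbb{P})$ satisfying the usual conditions. Let $\xi\in\mathcal{C}([-\tau,0];\mathbb{R}^d)$ be a deterministic continuous function, $\|\xi\|=\sup_{-\tau\le\theta\le0}|\xi(\theta)|$. The underlying stochastic delay differential equation is $dx(t)=f(x(t),x(t-\tau))\,dt+g(x(t),x(t-\tau))\,dW(t)$, $t>0$, with $x(t)=\xi(t)$ on $[-\tau,0]$. (H1) For every $l_1>0$ there is $L_{l_1}>0$ such that $|f(x,y)-f(\bar x,y)|\vee|g(x,y)-g(\bar x,y)|\le L_{l_1}|x-\bar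 x|$ for all $x,\bar x,y\in\mathbb{R}^d$ with $|x|\vee|\bar x|\vee|y|\le l_1$. (H2) There exist constants $q>0$, $K_1\ge0$, $K_2\ge0$ and a continuous function $V_1:\mathbb{R}^d\to\mathbb{R}_+$ such that for all $x,y\in\mathbb{R}^d$, $$(1+|x|^2)^{\frac q2-1}\big(\langle 2x,f(x,y)\rangle+((q-1)\vee1)|g(x,y)|^2\big)\le K_1(1+|x|^q+|y|^q)-K_2(V_1(x)-V_1(y)).$$ (H3) For every $M_1>0$ and every $\bar y\in\mathbb{R}^d$, $\lim_{y\to\bar y}\sup_{|x|\le M_1}\big[|f(x,y)-f(x,\bar y)|+|g(x,y)-g(x,\bar y)|\big]=0$. Truncated Euler–Maruyama (TEM) scheme. Fix a strictly increasing continuous function $\Phi:[1,\infty)\to\mathbb{R}_+$ with $\Phi(l)\to\infty$ as $l\to\infty$ such that $$\sup_{|x|\vee|y|\le l}\left(\frac{|f(x,y)|}{1+|x|}\vee\frac{|g(x,y)|^2}{(1+|x|)^2}\right)\le\Phi(l),\qquad \forall\, l\ge1,$$ with inverse $\Phi^{-1}:[\Phi(1),\infty)\to\mathbb{R}_+$. Fix $\mu\in(0,\frac12]$ and set $h_{\Phi,\mu}(\triangle)=K\triangle^{-\mu}$ for $\triangle\in(0,1]$, where $K=\Phi(\|\xi\|\vee1)$. Define $\Upsilon^{\triangle}_{\Phi,\mu}(x)=\big(|x|\wedge\Phi^{-1}(h_{\Phi,\mu}(\triangle))\big)\frac{x}{|x|}$, with $\frac{x}{|x|}=\mathbf 0$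 for $x=\mathbf 0$. For a positive integer $N$ with $\triangle=\tau/N\in(0,1]$, put $t_i=i\triangle$, $\triangle W_i=W(t_{i+1})-W(t_i)$, and define $z_i^{\triangle}=\xi(i\triangle)$ for $i=-N,\dots,0$, and for $i=0,1,\dots$ $$\breve z_{i+1}^{\triangle}=z_i^{\triangle}+f(z_i^{\triangle},z_{i-N}^{\triangle})\triangle+g(z_i^{\triangle},z_{i-N}^{\triangle})\triangle W_i,\qquad z_{i+1}^{\triangle}=\Upsilon^{\triangle}_{\Phi,\mu}(\breve z_{i+1}^{\triangle}).$$ *)

(* Defs.v *)
From HB Require Import structures.
From mathcomp Require Import all_boot all_order all_algebra.
From mathcomp Require Import all_classical all_reals all_analysis.

Set Implicit Arguments.
Unset Strict Implicit.
Unset Printing Implicit Defensive.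

Import Order.TTheory GRing.Theory Num.Theory.
Import numFieldNormedType.Exports.

Local Open Scope classical_set_scope.
Local Open Scope ring_scope.

(* The library norm on matrices is the max norm. [hsnorm] is the
   Hilbert-Schmidt norm, i.e. the Euclidean norm on column vectors. The
   topology on ['cV[R]_d] is the same for both norms. *)
Definition hsnorm {R : realType} {a b : nat} (A : 'M[R]_(a, b)) : R :=
  Num.sqrt (\sum_i \sum_j A i j ^+ 2).

Definition dotv {R : realType} {d : nat} (x y : 'cV[R]_d) : R :=
  \sum_i x i 0 * y i 0.

Section Probability.
Context {disp : measure_display} {Omega : measurableType disp} {R : realType}.
Variable P : probability Omega R.

(* Time is [0, +oo[: the values of [F] at negative times are irrelevant. *)
Definition filtration (F : R -> set (set Omega)) : Prop :=
  (forall t : R, 0 <= t -> sigma_algebra setT (F t) /\ F t `<=` measurable) /\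
  (forall s t : R, 0 <= s -> s <= t -> F s `<=` F t).

Definition usual_conditions (F : R -> set (set Omega)) : Prop :=
  [/\ measure_is_complete P,
      P.-negligible `<=` F 0 &
      forall t : R, 0 <= t -> F t = \bigcap_(s in `]t, +oo[) F s].

Definition borel_cV (m : nat) : set (set 'cV[R]_m) :=
  <<s [set U : set 'cV[R]_m | open U] >>.

(* [normal_prob] takes the standard deviation as second parameter. *)
Record brownian_motion (F : R -> set (set Omega)) (m : nat)
    (W : R -> Omega -> 'cV[R]_m) : Prop := BrownianMotion {
  bm_start : {ae P, forall w, W 0 w = 0};
  bm_continuous :
    {ae P, forall w, {within `[0, +oo[, continuous (fun t => W t w)}};
  bm_adapted : forall t : R, 0 <= t ->
    forall B, @borel_cV m B -> F t (W t @^-1` B);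
  bm_independent : forall s t : R, 0 <= s -> s < t ->
    forall A B, F s A -> @borel_cV m B ->
    P (A `&` [set w | B (W t w - W s w)]) =
      (P A * P [set w | B (W t w - W s w)%R])%E;
  bm_gaussian : forall s t : R, 0 <= s -> s < t ->
    forall B : 'I_m -> set R, (forall i, measurable (B i)) ->
    P [set w | forall i, B i ((W t w - W s w) i 0)] =
      (\prod_(i < m) normal_prob 0 (Num.sqrt (t - s)) (B i))%E }.

End Probability.

Section Coefficients.
Context {R : realType} {d m : nat}.
Variables (f : 'cV[R]_d -> 'cV[R]_d -> 'cV[R]_d)
          (g : 'cV[R]_d -> 'cV[R]_d -> 'M[R]_(d, m)).

Definition local_lipschitz1 : Prop :=
  forall l : R, 0 < l -> exists2 L : R, 0 < L &
    forall x x' y : 'cV[R]_d,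
      Num.max (Num.max (hsnorm x) (hsnorm x')) (hsnorm y) <= l ->
      Num.max (hsnorm (f x y - f x' y)) (hsnorm (g x y - g x' y))
        <= L * hsnorm (x - x').

Definition khasminskii (q : R) : Prop :=
  0 < q /\
  exists (K1 K2 : R) (V1 : 'cV[R]_d -> R),
    [/\ 0 <= K1, 0 <= K2, continuous V1, (forall x, 0 <= V1 x) &
      forall x y : 'cV[R]_d,
        (1 + hsnorm x ^+ 2) `^ (q / 2 - 1) *
          (dotv (2 *: x) (f x y) + Num.max (q - 1) 1 * hsnorm (g x y) ^+ 2)
        <= K1 * (1 + hsnorm x `^ q + hsnorm y `^ q) - K2 * (V1 x - V1 y)].

Definition locally_uniformly_continuous2 : Prop :=
  forall (M : R) (y0 : 'cV[R]_d), 0 < M ->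
    ereal_sup [set (hsnorm (f x y - f x y0) + hsnorm (g x y - g x y0))%:E
              | x in [set x | hsnorm x <= M]] @[y --> y0] --> 0%E.

(* [Phi] and [Phiinv] matter only on [1, +oo[ and [Phi 1, +oo[ respectively;
   being continuous and unbounded, [Phi] maps the former onto the latter, so
   that the left inverse [Phiinv] is determined there. *)
Definition truncation_function (Phi Phiinv : R -> R) : Prop :=
  [/\ (forall l, 1 <= l -> 0 <= Phi l),
      {in `[1, +oo[ &, {homo Phi : k l / k < l}},
      {within `[1, +oo[, continuous Phi},
      Phi l @[l --> +oo] --> +oo &
      {in `[1, +oo[, cancel Phi Phiinv}] /\
  forall l, 1 <= l ->
    (ereal_sup [set (Num.max (hsnorm (f p.1 p.2) / (1 + hsnorm p.1))
                            (hsnorm (g p.1 p.2) ^+ 2 / (1 + hsnorm p.1) ^+ 2))%:E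
              | p in [set p : 'cV[R]_d * 'cV[R]_d |
                        (Num.max (hsnorm p.1) (hsnorm p.2) <= l)%R]]
    <= (Phi l)%:E)%E.

Variables (tau : R) (xi : R -> 'cV[R]_d) (Phi Phiinv : R -> R) (mu : R).

Definition supnorm : R := sup [set hsnorm (xi t) | t in `[- tau, 0]].

Definition hPhi (D : R) : R := Phi (Num.max supnorm 1) * D `^ (- mu).

(* In accordance with the convention x / |x| = 0 at x = 0, one has 0^-1 = 0. *)
Definition truncation (D : R) (x : 'cV[R]_d) : 'cV[R]_d :=
  Num.min (hsnorm x) (Phiinv (hPhi D)) *: ((hsnorm x)^-1 *: x).

Definition stepsize (N : nat) : R := tau / N%:R.

(* For a driving path [w], [tem_segment N w n j] is z_(n - j): the recursion
   carries the past of the scheme, as needed for the delayed argument. *)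
Fixpoint tem_segment (N : nat) (w : R -> 'cV[R]_m) (n j : nat) : 'cV[R]_d :=
  let D := stepsize N in
  match n, j with
  | 0, _ => xi (- (j%:R * D))
  | n'.+1, 0 =>
      let z := tem_segment N w n' 0 in
      let zdelay := tem_segment N w n' N in
      truncation D
        (z + D *: f z zdelay + g z zdelay *m (w (n'.+1%:R * D) - w (n'%:R * D)))
  | n'.+1, j'.+1 => tem_segment N w n' j'
  end.

Definition tem (N : nat) (w : R -> 'cV[R]_m) (i : int) : 'cV[R]_d :=
  match i with
  | Posz n => tem_segment N w n 0
  | Negz n => tem_segment N w 0 n.+1
  end.

Lemma tem_segmentE N w (n j : nat) :
  tem_segment N w n j = tem N w (n%:Z - j%:Z).
Proof.
elim: n j => [|n IHn] [|j].
- by [].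
- by rewrite sub0r -NegzE.
- by rewrite subr0.
by rewrite /= IHn [in RHS]intS (intS j) opprD addrACA subrr add0r.
Qed.

Lemma tem_initial N w (i : int) : i <= 0 ->
  tem N w i = xi (i%:~R * stepsize N).
Proof.
case: i => [[|n]|n] //= _; first by rewrite !mul0r oppr0.
by rewrite NegzE mulrNz mulNr.
Qed.

Lemma tem_step N w (i : nat) :
  let D := stepsize N in
  let z := tem N w in
  z (i.+1)%:Z = truncation D
    (z i%:Z + D *: f (z i%:Z) (z (i%:Z - N%:Z))
     + g (z i%:Z) (z (i%:Z - N%:Z)) *m (w (i.+1%:R * D) - w (i%:R * D))).
Proof. by move=> D z; rewrite /z /= (tem_segmentE N w i N). Qed.

End Coefficients.

(* Main.v *)
Require Import Defs.
From HB Require Import structures.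
From mathcomp Require Import all_boot all_order all_algebra.
From mathcomp Require Import all_classical all_reals all_analysis.
From mathcomp Require Import measurable_realfun ring lra.

Set Implicit Arguments.
Unset Strict Implicit.
Unset Printing Implicit Defensive.

Import Order.TTheory GRing.Theory Num.Theory.
Import numFieldNormedType.Exports.

Local Open Scope classical_set_scope.
Local Open Scope ring_scope.

(** The truncation makes the scheme explicit yet tame: the truncation level
    [rho] solves [Phi rho = K D^(-mu)], so that along the scheme [|f|] and
    [|g|^2] are at most [K D^(-1/2)] times [1 + |z|], respectively its square,
    because [mu <= 1/2] and [D <= 1]; moreover truncating only decreases the
    norm.  It therefore suffices to control [(1 + |.|^2)^p] with [p = q/2] over
    one step [z + D f + g DW] from a state that is bounded for each stepsize.

    For a fixed state (lemma [one_step]), put [u = 1 + |z|^2] and [y = z + D f].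
    Since [DW] is symmetric, one may average over [DW] and [-DW], and then
    [1 + |y +- g DW|^2 = u (1 + al + be +- ga)] with [al] of order [D^(1/2)],
    [be = |g DW|^2 / u] and [ga = 2 <y, g DW> / u].  The scalar inequality
    [sym_powR_le] bounds the average of the [p]-th powers by
    [1 + p al + p max(2p-1, 1) be] up to an error quadratic in [al] and [be].
    Averaging kills the odd terms [ga] and [ga^3], which would be of order
    [D^(1/2)] and [D^(3/4)] when [mu = 1/2]; the error is of order [D] because
    [be] is at most [D^(1/2)] times a power of a standard normal vector.  As
    [E |g DW|^2 <= D |g|^2], the first-order terms are [D p u^(p-1)] times
    exactly the left-hand side of the Khasminskii condition.

    The increment is independent of the past, so the state may be frozen
    ([ge0_integral_indep], [conditional_step]); this needs the states to be
    measurable, which the two continuity hypotheses on the coefficients give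
    ([coef_cvg], [measurable_fun_cont2]).  Writing [a_k] and [b_k] for the
    expectations of [(1 + |z|^2)^p] and [K2 V1(z)] at time [k - N], the result is
      [a_(n+N+1) + D p b_(n+N)
         <= (1 + D c) a_(n+N) + D c a_n + D c + D p b_n].
    The terms in [V1] telescope in the functional
    [a_(n+N) + D p (b_n + ... + b_(n+N-1))], whose initial value is bounded
    uniformly in [D] since [N D = tau], and a Gronwall argument
    ([discrete_gronwall]) concludes.  All the expectations are finite because the
    scheme is bounded; that [K2 V1] is bounded on balls follows from the
    Khasminskii condition itself ([lyapunov_bounded]). *)

(** * Scalar inequalities for real powers *)

Section Scalar.
Context {R : realType}.
Implicit Types p t x y r s c : R.

(** Young's inequality for the pair [x], [1]. *)
Lemma bernoulli_powR p x : 1 <= p -> 0 <= x -> 1 + p * (x - 1) <= x `^ p.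
Proof.
rewrite le_eqVlt => /predU1P[<- x0|p1 x0].
  by rewrite powRr1//; lra.
have p0 : 0 < p by lra.
have := @conjugate_powR R x 1 p (p / (p - 1)) x0 ler01 p0.
rewrite divr_gt0 ?subr_gt0// => /(_ isT).
rewrite invf_div mulrBl divff ?gt_eqF// mul1r.
rewrite addrC subrK => /(_ erefl); rewrite powR1 mulr1 mul1r.
rewrite -(ler_pM2l p0) mulrDr mulrCA divff ?gt_eqF// mulr1.
rewrite mulrBr mulr1 divff ?gt_eqF//; lra.
Qed.

(** The previous inequality with exponent [p^-1], applied to [x `^ p]. *)
Lemma powR_le_tangent p x : 0 < p -> p <= 1 -> 0 <= x -> x `^ p <= 1 + p * (x - 1).
Proof.
move=> p0 p1 x0.
have := @bernoulli_powR p^-1 (x `^ p) _ (powR_ge0 _ _).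
rewrite invf_ge1// => /(_ p1).
rewrite -powRrM divff ?gt_eqF// powRr1// -(ler_pM2l p0) mulrDr mulr1 mulrA.
rewrite divff ?gt_eqF// mul1r; lra.
Qed.

(** By the mean value theorem [h x = k c * x] with [0 < c < x].  Losing the
    factor [1 / n.+1] of integration is harmless, and iterating the lemma turns a
    bound on a fourth derivative into a Taylor bound of order four. *)
Lemma normr_le_of_derive (h k : R -> R) (M : R) n :
  (forall x, 0 <= x <= 1/2 -> is_derive x 1 h (k x)) -> h 0 = 0 ->
  (forall x, 0 <= x <= 1/2 -> `|k x| <= M * x ^+ n) ->
  forall x, 0 <= x <= 1/2 -> `|h x| <= M * x ^+ n.+1.
Proof.
move=> hk h0 kM x /andP[x0 x12].
move: x0; rewrite le_eqVlt => /predU1P[<-|x0].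
  by rewrite h0 normr0 expr0n mulr0.
have dh y : y \in `[0, x] -> is_derive y 1 h (k y).
  by rewrite in_itv/= => /andP[y0 yx]; apply: hk; rewrite y0 (le_trans yx).
have hcont : {within `[0, x], continuous h}.
  apply: derivable_within_continuous => y /dh dhy; exact: ex_derive.
have [c] := MVT x0 (fun y hy => dh y (subset_itv_oo_cc hy)) hcont.
rewrite in_itv/= => /andP[c0 cx]; rewrite h0 !subr0 => ->.
rewrite normrM (gtr0_norm x0) exprSr mulrA ler_pM2r//.
have M0 : 0 <= M.
  have := kM c; rewrite (ltW c0) (le_trans (ltW cx))// => /(_ isT).
  by move/(le_trans (normr_ge0 _)); rewrite pmulr_lge0// exprn_gt0.
apply: le_trans (kM _ _) _; first by rewrite (ltW c0) (le_trans (ltW cx)).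
by rewrite ler_wpM2l// lerXn2r// ?nnegrE; lra.
Qed.

(** Twice the even and the odd part of [r |-> (1 + r) `^ t]: differentiation
    exchanges them and lowers [t] by one. *)
Definition even_powR t r := (1 + r) `^ t + (1 - r) `^ t.
Definition odd_powR t r := (1 + r) `^ t - (1 - r) `^ t.

Lemma is_derive_1D t r : 0 <= r <= 1/2 ->
  is_derive r 1 (fun r => (1 + r) `^ t) (t * (1 + r) `^ (t - 1)).
Proof.
move=> r1; have r10 : 0 < 1 + r by lra.
have h1 : is_derive r 1 (fun r : R => 1 + r) 1.
  have h := is_deriveD (is_derive_cst (1 : R) r (1 : R)) (is_derive_id r (1 : R)).
  by have {h} := is_derive_eq h (add0r _).
have := is_derive1_comp (f := fun x : R => x `^ t) (g := fun r => 1 + r) (is_derive1_powR t r10) h1.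
by rewrite mulr1.
Qed.

Lemma is_derive_1B t r : 0 <= r <= 1/2 ->
  is_derive r 1 (fun r => (1 - r) `^ t) (- (t * (1 - r) `^ (t - 1))).
Proof.
move=> r1; have r10 : 0 < 1 - r by lra.
have h1 : is_derive r 1 (fun r : R => 1 - r) (-1).
  have h := is_deriveB (is_derive_cst (1 : R) r (1 : R)) (is_derive_id r (1 : R)).
  by have {h} := is_derive_eq h (sub0r _).
have := is_derive1_comp (f := fun x : R => x `^ t) (g := fun r => 1 - r) (is_derive1_powR t r10) h1.
by rewrite mulrN1.
Qed.

Lemma is_derive_even_powR t r : 0 <= r <= 1/2 ->
  is_derive r 1 (even_powR t) (t * odd_powR (t - 1) r).
Proof.
move=> r1; rewrite /even_powR /odd_powR mulrBr.
exact: is_deriveD (is_derive_1D t r1) (is_derive_1B t r1).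
Qed.

Lemma is_derive_odd_powR t r : 0 <= r <= 1/2 ->
  is_derive r 1 (odd_powR t) (t * even_powR (t - 1) r).
Proof.
move=> r1; rewrite /even_powR /odd_powR mulrDr -[X in _ + X]opprK.
exact: is_deriveB (is_derive_1D t r1) (is_derive_1B t r1).
Qed.

Lemma powR_le_pow2 t x : 1/2 <= x <= 2 -> x `^ t <= 2 `^ `|t|.
Proof.
move=> x12; have x0 : 0 < x by lra.
have [t0|t0] := leP 0 t.
  by rewrite ger0_norm// ge0_ler_powR ?nnegrE; lra.
rewrite ltr0_norm// -[t in leLHS]opprK powRN -powR_inv1 ?powR_ge0//.
rewrite -powRrM mulrC powRrM powR_inv1; last lra.
rewrite ge0_ler_powR ?nnegrE ?invr_ge0; try lra.
by rewrite -[leRHS]invrK lef_pV2 ?posrE; lra.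
Qed.

(** Taylor expansion at [0] of an even function, so that the remainder is of
    order four: four integrations, starting from a bound on the fourth derivative,
    which is a multiple of [even_powR (p - 4)]. *)
Lemma even_powR_quartic p : exists2 C, 0 <= C &
  forall r, 0 <= r <= 1/2 ->
    even_powR p r <= 2 + p * (p - 1) * r ^+ 2 + C * r ^+ 4.
Proof.
set t := p - 1 - 1 - 1 - 1.
pose C4 := 2 * 2 `^ `|t|.
pose C3 := `|p - 1 - 1 - 1| * C4.
pose C2 := `|p - 1 - 1| * C3.
pose C1 := `|p - 1| * C2.
pose C0 := `|p| * C1.
have E4 r : 0 <= r <= 1/2 -> `|even_powR t r| <= C4 * r ^+ 0.
  move=> r1; rewrite expr0 mulr1 ger0_norm ?addr_ge0 ?powR_ge0//.
  by rewrite /C4 mulr2n mulrDl mul1r lerD// powR_le_pow2; lra.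
have O3 r : 0 <= r <= 1/2 -> `|odd_powR (p - 1 - 1 - 1) r| <= C3 * r ^+ 1.
  move: r.
  apply: (normr_le_of_derive (k := fun r => (p - 1 - 1 - 1) * even_powR t r)) => [r r1||r r1].
  - exact: is_derive_odd_powR.
  - by rewrite /odd_powR subr0 addr0 subrr.
  - by rewrite normrM -mulrA ler_wpM2l// E4.
have E2 r : 0 <= r <= 1/2 -> `|even_powR (p - 1 - 1) r - 2| <= C2 * r ^+ 2.
  move: r.
  apply: (normr_le_of_derive (k := fun r => (p - 1 - 1) * odd_powR (p - 1 - 1 - 1) r)) => [r r1||r r1].
  - have h := is_deriveB (is_derive_even_powR (p - 1 - 1) r1) (is_derive_cst (2 : R) r (1 : R)).
    by have {h} := is_derive_eq h (subr0 _).
  - by rewrite /even_powR subr0 addr0 powR1; lra.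
  - by rewrite normrM -mulrA ler_wpM2l// O3.
have O1 r : 0 <= r <= 1/2 -> `|odd_powR (p - 1) r - 2 * (p - 1) * r| <= C1 * r ^+ 3.
  move: r.
  apply: (normr_le_of_derive (k := fun r => (p - 1) * (even_powR (p - 1 - 1) r - 2))) => [r r1||r r1].
  - have dl : is_derive r 1 (fun r : R => 2 * (p - 1) * r) (2 * (p - 1)).
      by apply: is_derive_eq; rewrite /GRing.scale/=; ring.
    have h := is_deriveB (is_derive_odd_powR (p - 1) r1) dl.
    by apply: is_derive_eq h _; ring.
  - by rewrite /odd_powR subr0 addr0 subrr mulr0 subrr.
  - by rewrite normrM /C1 -[leRHS]mulrA ler_wpM2l// E2.
have E0 r : 0 <= r <= 1/2 -> `|even_powR p r - (2 + p * (p - 1) * r ^+ 2)| <= C0 * r ^+ 4.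
  move: r.
  apply: (normr_le_of_derive (k := fun r => p * (odd_powR (p - 1) r - 2 * (p - 1) * r))) => [r r1||r r1].
  - have dq : is_derive r 1 (fun r : R => 2 + p * (p - 1) * r ^+ 2) (p * (2 * (p - 1) * r)).
      apply: is_derive_eq; rewrite /GRing.scale/=; ring.
    have h := is_deriveB (is_derive_even_powR p r1) dq.
    by apply: is_derive_eq h _; ring.
  - by rewrite /even_powR subr0 addr0 powR1 expr0n/=; lra.
  - by rewrite normrM /C0 -[leRHS]mulrA ler_wpM2l// O1.
exists C0 => [|r /E0]; last by rewrite ler_norml => /andP[_]; lra.
by rewrite /C0 /C1 /C2 /C3 /C4 !mulr_ge0// ?powR_ge0.
Qed.

End Scalar.

Section Scalar2.
Context {R : realType}.
Implicit Types p t x y r s c : R.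

Lemma even_powRN p r : even_powR p (- r) = even_powR p r.
Proof. by rewrite /even_powR opprK addrC. Qed.

(** For [1/2 <= |r|] the left-hand side is at most [2 * 2 `^ p], which is
    absorbed by [32 * 2 `^ p * r ^+ 4]. *)
Lemma even_powR_le p : 1 <= p -> exists2 C, 0 <= C &
  forall r, `|r| <= 1 ->
    even_powR p r <= 2 + p * (p - 1) * r ^+ 2 + C * r ^+ 4.
Proof.
move=> p1; have [C C0 hC] := even_powR_quartic p.
exists (C + 32 * 2 `^ p) => [|r r1]; first by rewrite addr_ge0// mulr_ge0// powR_ge0.
wlog r0 : r r1 / 0 <= r.
  move=> H; have [/H|r0] := leP 0 r; first exact.
  have := H (- r); rewrite normrN even_powRN sqrrN -[in (- r) ^+ 4]mulN1r exprMn.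
  rewrite -signr_odd expr0 mul1r; apply=> //; lra.
rewrite ger0_norm// in r1.
have r40 : 0 <= r ^+ 4 by rewrite exprn_ge0.
have p20 : 0 <= 2 `^ p by rewrite powR_ge0.
have [r12|r12] := leP r (1/2).
  apply: le_trans (hC r _) _; first lra.
  by rewrite lerD2l ler_wpM2r//; lra.
have h1 : even_powR p r <= 2 * 2 `^ p.
  rewrite /even_powR mulr2n mulrDl mul1r lerD// ge0_ler_powR ?nnegrE//; lra.
have r4 : 1 <= 16 * r ^+ 4.
  have -> : 16 * r ^+ 4 = (2 * r) ^+ 4 by ring.
  by rewrite exprn_ege1//; lra.
have r20 : 0 <= p * (p - 1) * r ^+ 2 by rewrite !mulr_ge0//; lra.
have : 2 `^ p * 1 <= 2 `^ p * (16 * r ^+ 4) by rewrite ler_wpM2l.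
have : 0 <= C * r ^+ 4 by rewrite mulr_ge0.
move: h1 r20; lra.
Qed.

Lemma expr_sub1_le x n : 1 <= x -> x ^+ n - 1 <= n%:R * (x - 1) * x ^+ n.
Proof.
move=> x1; elim: n => [|n IH]; first by rewrite !mul0r expr0 subrr.
have -> : x ^+ n.+1 - 1 = x * (x ^+ n - 1) + (x - 1) by rewrite exprS; ring.
have -> : n.+1%:R * (x - 1) * x ^+ n.+1 = x * (n%:R * (x - 1) * x ^+ n) + (x - 1) * x ^+ n.+1.
  by rewrite -natr1 exprS; ring.
apply: lerD; first by rewrite ler_wpM2l//; lra.
by rewrite ler_peMr ?exprn_ege1//; lra.
Qed.

(** Comparison with the integer power [n.+1], from above when [0 <= s] and by
    Bernoulli's inequality when [s < 0]. *)
Lemma powR_sub1_le t n s : 0 <= t -> t <= n.+1%:R -> -1 <= s ->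
  `|(1 + s) `^ t - 1| <= n.+1%:R * `|s| * (1 + `|s|) ^+ n.+1.
Proof.
move=> t0 tn s1.
have n0 : (0 : R) <= n.+1%:R by rewrite ler0n.
have [s0|s0] := leP 0 s.
  rewrite (ger0_norm s0) ger0_norm; last first.
    by rewrite subr_ge0 -[leLHS](powRr0 (1 + s)) ler_powR//; lra.
  have := @expr_sub1_le (1 + s) n.+1; rewrite [1 + s - 1]addrAC subrr add0r.
  move/(_ ltac:(lra)); apply: le_trans; rewrite lerD2r.
  by rewrite -powR_mulrn ?ler_powR//; lra.
rewrite (ltr0_norm s0).
have h1 : 1 <= (1 - s) ^+ n.+1 by rewrite exprn_ege1//; lra.
have hM : n.+1%:R * (- s) * 1 <= n.+1%:R * (- s) * (1 - s) ^+ n.+1.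
  by rewrite ler_wpM2l// mulr_ge0//; lra.
apply: le_trans hM; rewrite mulr1.
have hle1 : (1 + s) `^ t <= 1.
  have e1 : (1 : R) `^ t = 1 by rewrite powR1.
  rewrite -[leRHS]e1; apply: ge0_ler_powR; rewrite ?nnegrE//; lra.
rewrite ler0_norm ?subr_le0// opprB.
have : 1 + n.+1%:R * s <= (1 + s) `^ t; last lra.
move: s1; rewrite le_eqVlt => /predU1P[<-|s1].
  apply: le_trans (powR_ge0 _ _); rewrite mulrN1 subr_le0.
  by rewrite ler1n.
have := @bernoulli_powR _ n.+1%:R (1 + s).
rewrite [1 + s - 1]addrAC subrr add0r ler1n => /(_ isT ltac:(lra)) /le_trans; apply.
by rewrite ger_powR//; apply/andP; split; lra.
Qed.

Lemma powR_le_expr p n x y : 0 <= p -> p <= n%:R -> 0 <= x -> x <= y -> 1 <= y ->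
  x `^ p <= y ^+ n.
Proof.
move=> p0 pn x0 xy y1.
apply: (@le_trans _ _ (y `^ p)); first by rewrite ge0_ler_powR ?nnegrE//; lra.
by rewrite -powR_mulrn ?ler_powR//; lra.
Qed.

(** Concavity: each power lies below its tangent at [1], and the contributions
    of [ga] cancel. *)
Lemma sym_powR_le1 p al be ga : 0 < p -> p <= 1 -> 0 <= 1 + al -> 0 <= be ->
  ga ^+ 2 <= 4 * (1 + al) * be ->
  (1 + al + be + ga) `^ p + (1 + al + be - ga) `^ p <= 2 * (1 + p * (al + be)).
Proof.
move=> p0 p1 al0 be0 h.
have : `|ga| <= 1 + al + be.
  rewrite -ler_sqr ?nnegrE//; last lra.
  rewrite real_normK ?num_real//; apply: (le_trans h).
  by have := sqr_ge0 (1 + al - be); nra.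
rewrite ler_norml => /andP[h1 h2].
have := @powR_le_tangent _ p (1 + al + be + ga) p0 p1 ltac:(lra).
have := @powR_le_tangent _ p (1 + al + be - ga) p0 p1 ltac:(lra).
lra.
Qed.

(** With [A = 1 + al + be] and [r = ga / A], the left-hand side is
    [A `^ p * even_powR p r].  The hypothesis on [ga] gives [r ^+ 2 <= 1] and
    [A * r ^+ 2 <= 4 * be], so the quadratic term of [even_powR] produces the
    term [2 * p * (p - 1) * be]; all the rest is quadratic in [al] and [be]. *)
Lemma sym_powR_le2 p c : 1 <= p -> 0 <= c -> exists n, exists2 C, 0 <= C &
  forall al be ga, `|al| <= c -> 0 < 1 + al -> 0 <= be ->
  ga ^+ 2 <= 4 * (1 + al) * be ->
  (1 + al + be + ga) `^ p + (1 + al + be - ga) `^ p <=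
  2 * (1 + p * (al + be) + 2 * p * (p - 1) * be +
       C * (al ^+ 2 + be ^+ 2) * (1 + be) ^+ n).
Proof.
move=> p1 c0; have [C4 C40 hC4] := even_powR_le p1.
pose n := (Num.truncn p).+1.
have pn : p < n%:R by have := truncnS_gt p.
have n1 : (1 : R) <= n%:R by rewrite ler1n.
have p0' : 0 < p by lra.
have p0 : 0 <= p := ltW p0'.
have p10 : 0 <= p - 1 by lra.
have pp0 : 0 <= p * (p - 1) by exact: mulr_ge0.
have n0 : (0 : R) <= n%:R by lra.
have p1n : p - 1 <= n%:R by lra.
pose Kc := 2 * p * n%:R + 3 * p * (p - 1) * n%:R + 96 * C4.
have Kc0 : 0 <= Kc.
  exact: addr_ge0 (addr_ge0 (mulr_ge0 (mulr_ge0 (ler0n _ _) p0) n0)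
    (mulr_ge0 (mulr_ge0 (mulr_ge0 (ler0n _ _) p0) p10) n0)) (mulr_ge0 (ler0n _ _) C40).
exists n, (Kc * (1 + c) ^+ n) => [|al be ga alc al0 be0 hga].
  by apply: mulr_ge0 => //; rewrite exprn_ge0// addr_ge0.
pose s := al + be; pose A := 1 + s.
have A0 : 0 < A by rewrite /A /s; lra.
have EA : 1 + al + be = A by rewrite /A /s; ring.
rewrite EA.
pose r := ga / A; pose G := (1 + `|s|) ^+ n; pose Q := al ^+ 2 + be ^+ 2.
have Ega : ga = A * r by rewrite /r mulrCA divff ?gt_eqF// mulr1.
have al2 : 0 <= al ^+ 2 by exact: sqr_ge0.
have be2 : 0 <= be ^+ 2 by exact: sqr_ge0.
have Q0 : 0 <= Q by rewrite addr_ge0.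
have G1 : 1 <= G by rewrite exprn_ege1// lerDl.
have GE : G <= (1 + c) ^+ n * (1 + be) ^+ n.
  rewrite -exprMn lerXn2r ?nnegrE ?addr_ge0 ?mulr_ge0//; try lra.
  have := ler_normD al be; rewrite (ger0_norm be0).
  have : 0 <= c * be by rewrite mulr_ge0.
  rewrite -/s; nra.
have s2 : s ^+ 2 <= 2 * Q.
  by rewrite /s /Q; have := sqr_ge0 (al - be); nra.
have sbe : `|s| * be <= 3 * Q / 2.
  have := sqr_ge0 (`|s| - be); rewrite sqrrB real_normK ?num_real//.
  have : be ^+ 2 <= Q by rewrite lerDr.
  rewrite -mulr_natr; lra.
have hga2 : A * r ^+ 2 <= 4 * be.
  rewrite -(ler_pM2l A0) mulrA -expr2 -exprMn -Ega; apply: (le_trans hga).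
  have -> : A * (4 * be) = 4 * A * be by ring.
  by rewrite ler_wpM2r// ler_wpM2l// -EA; lra.
have r2 : r ^+ 2 <= 1.
  rewrite -(ler_pM2l (exprn_gt0 2 A0)) -exprMn -Ega mulr1; apply: (le_trans hga).
  by rewrite -EA; have := sqr_ge0 (1 + al - be); nra.
have r1 : `|r| <= 1 by rewrite -(@ler_sqr R) ?nnegrE// real_normK ?num_real// expr1n.
have r20 : 0 <= r ^+ 2 by exact: sqr_ge0.
move: r1; rewrite ler_norml => /andP[r11 r12].
have -> : A + ga = A * (1 + r) by rewrite Ega; ring.
have -> : A - ga = A * (1 - r) by rewrite Ega; ring.
have rp : 0 <= 1 + r by rewrite -(subrr 1) lerD2l.
have rm : 0 <= 1 - r by rewrite subr_ge0.
rewrite !powRM ?(ltW A0)//.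
rewrite -mulrDr -/(even_powR p r).
have Ap0 : 0 <= A `^ p by exact: powR_ge0.
have hs : -1 <= s by rewrite /A in A0; lra.
have n'E : n = (Num.truncn p).+1 by [].
have hL : `|A `^ (p - 1) - 1| <= n%:R * `|s| * G.
  by rewrite /G n'E; apply: powR_sub1_le; rewrite -?n'E.
have ApE : A * A `^ (p - 1) = A `^ p by rewrite mulr_powRB1// ltW.
(* Convexity gives A `^ p <= 1 + p * s * A `^ (p - 1); then replace
   A `^ (p - 1) by 1, at the cost of a second-order error. *)
have L1 : A `^ p <= 1 + p * s + 2 * p * n%:R * (Q * G).
  have h1 : A `^ p <= 1 + p * s * A `^ (p - 1).
    have := @bernoulli_powR _ p A^-1 p1; rewrite invr_ge0 => /(_ (ltW A0)) h.
    have e : A `^ p * A^-1 `^ p = 1.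
      by rewrite -powRM ?invr_ge0 ?ltW// divff ?gt_eqF// powR1.
    have {h} := ler_wpM2l Ap0 h; rewrite e.
    have -> : A `^ p * (1 + p * (A^-1 - 1)) = A `^ p + p * (A^-1 * A `^ p - A `^ p) by ring.
    rewrite -[in A^-1 * _]ApE mulKf ?gt_eqF// -[in X in _ + p * (_ - X) <= _]ApE.
    by rewrite /A; nra.
  apply: (le_trans h1); rewrite -addrA lerD2l.
  have -> : p * s * A `^ (p - 1) = p * s + p * (s * (A `^ (p - 1) - 1)) by ring.
  rewrite lerD2l -!mulrA [leRHS]mulrCA ler_wpM2l//.
  apply: (le_trans (ler_norm _)); rewrite normrM.
  apply: (@le_trans _ _ (`|s| * (n%:R * `|s| * G))); first by rewrite ler_wpM2l.
  have -> : `|s| * (n%:R * `|s| * G) = n%:R * (s ^+ 2 * G).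
    by rewrite -(real_normK (num_real s)); ring.
  have -> : 2 * (n%:R * (Q * G)) = n%:R * (2 * Q * G) by ring.
  by rewrite ler_wpM2l ?ler_wpM2r//; lra.
have L2 : A `^ p * r ^+ 2 <= 4 * be + 6 * n%:R * (Q * G).
  rewrite -ApE mulrAC.
  apply: (@le_trans _ _ (4 * be * A `^ (p - 1))); first by rewrite ler_wpM2r ?powR_ge0.
  have : be * A `^ (p - 1) <= be + be * (n%:R * `|s| * G).
    rewrite -[X in _ <= X + _]mulr1 -mulrDr ler_wpM2l//.
    by move: hL; rewrite ler_norml => /andP[_]; lra.
  have -> : be * (n%:R * `|s| * G) = n%:R * (`|s| * be * G) by ring.
  have : n%:R * (`|s| * be * G) <= n%:R * (3 * Q / 2 * G).
    by rewrite ler_wpM2l ?ler_wpM2r//; lra.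
  lra.
have ApG : A `^ p <= G.
  apply: (powR_le_expr p0 (ltW pn) (ltW A0)); last by rewrite lerDl.
  by rewrite lerD2l ler_norm.
(* If A is not small, r ^+ 2 is of order be; if A < 1/2 then 1/2 < |s| and
   the trivial bound 1 is already of order s ^+ 2. *)
have L3 : A `^ p * r ^+ 4 <= 192 * (Q * G).
  have -> : r ^+ 4 = (r ^+ 2) ^+ 2 by rewrite -exprM.
  have QG : 0 <= Q * G by rewrite mulr_ge0// (le_trans ler01 G1).
  have [s12|s12] := leP (-1/2) s.
    have hr : r ^+ 2 <= 8 * be.
      by have : 1/2 * r ^+ 2 <= A * r ^+ 2; [rewrite ler_wpM2r// /A; lra|lra].
    apply: (@le_trans _ _ (G * (64 * Q))); last lra.
    rewrite ler_pM ?sqr_ge0//.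
    apply: (@le_trans _ _ ((8 * be) ^+ 2)); first by rewrite lerXn2r ?nnegrE//; lra.
    by rewrite exprMn /Q; lra.
  have h1 : A `^ p * (r ^+ 2) ^+ 2 <= 1.
    rewrite mulr_ile1 ?sqr_ge0//; last by rewrite exprn_ile1.
    have e1 : (1 : R) `^ p = 1 by rewrite powR1.
    rewrite -[leRHS]e1 ge0_ler_powR ?nnegrE ?(ltW A0)//; rewrite /A; lra.
  apply: (le_trans h1).
  have : 1 <= 4 * s ^+ 2 by nra.
  have : Q * 1 <= Q * G by rewrite ler_wpM2l.
  lra.
have hE := ler_wpM2l Ap0 (hC4 r ltac:(by rewrite ler_norml r11 r12)).
have {}L2 := ler_wpM2l pp0 L2.
have {}L3 := ler_wpM2l C40 L3.
have : Kc * (Q * G) <= Kc * (Q * ((1 + c) ^+ n * (1 + be) ^+ n)).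
  by rewrite ler_wpM2l// ler_wpM2l.
have -> : Kc * (1 + c) ^+ n * (al ^+ 2 + be ^+ 2) * (1 + be) ^+ n =
    Kc * (Q * ((1 + c) ^+ n * (1 + be) ^+ n)).
  by rewrite -/Q; ring.
set X := _ * (Q * (_ * _)); set Y := Q * G; rewrite /Kc => hX.
move: (L2) (L3); rewrite -/Y => {}L2 {}L3.
rewrite -/s.
apply: le_trans hE _.
have -> : A `^ p * (2 + p * (p - 1) * r ^+ 2 + C4 * r ^+ 4) =
  2 * A `^ p + p * (p - 1) * (A `^ p * r ^+ 2) + C4 * (A `^ p * r ^+ 4) by ring.
apply: le_trans (_ : 2 * (1 + p * s + 2 * p * n%:R * Y) +
  p * (p - 1) * (4 * be + 6 * n%:R * Y) + C4 * (192 * Y) <= _).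
  by rewrite lerD// lerD// ler_wpM2l.
lra.
Qed.

(** The pointwise bound behind the Khasminskii coefficient: for [p = q / 2],
    [Num.max (2 * p - 1) 1] is the factor [max (q - 1) 1] of [|g|^2]. *)
Lemma sym_powR_le p c : 0 < p -> 0 <= c -> exists n, exists2 C, 0 <= C &
  forall al be ga, `|al| <= c -> 0 < 1 + al -> 0 <= be ->
  ga ^+ 2 <= 4 * (1 + al) * be ->
  (1 + al + be + ga) `^ p + (1 + al + be - ga) `^ p <=
  2 * (1 + p * al + p * Num.max (2 * p - 1) 1 * be +
       C * (al ^+ 2 + be ^+ 2) * (1 + be) ^+ n).
Proof.
move=> p0 c0; have [p1|p1] := leP 1 p.
  have [n [C C0 hC]] := sym_powR_le2 p1 c0.
  exists n, C => // al be ga h1 h2 h3 h4.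
  apply: (le_trans (hC _ _ _ h1 h2 h3 h4)).
  have -> : Num.max (2 * p - 1) 1 = 2 * p - 1 by rewrite max_l//; lra.
  by rewrite ler_wpM2l// lerD2r; lra.
exists 0, 0 => // al be ga h1 h2 h3 h4.
apply: (le_trans (sym_powR_le1 p0 (ltW p1) (ltW h2) h3 h4)).
have -> : Num.max (2 * p - 1) 1 = 1 by rewrite max_r//; lra.
by rewrite ler_wpM2l//; lra.
Qed.

End Scalar2.

(** * A Gronwall inequality with delay *)

Section Real.
Context {R : realType}.

(** [a n] and [v n] describe the state [N] steps before [a (n + N)].  The terms
    in [v] telescope in [S n := a (n + N) + D * p * \sum_(k < N) v (n + k)], and
    the induction bounds [S n] together with all the earlier values of [a]. *)
Lemma discrete_gronwall (a v : nat -> R) (N : nat) (D p c S0 : R) :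
  0 <= D -> 0 <= p -> 0 <= c -> 1 <= S0 -> (forall k, 0 <= v k) ->
  (forall k, (k <= N)%N -> a k <= S0) ->
  a N + D * p * (\sum_(k < N) v k) <= S0 ->
  (forall n, a (n + N).+1 + D * p * v (n + N)%N <=
     (1 + D * c) * a (n + N)%N + D * c * a n + D * c + D * p * v n) ->
  forall n, a (n + N)%N <= S0 * (1 + 3 * (D * c)) ^+ n.
Proof.
move=> D0 p0 c0 S1 v0 hinit hS rec.
set r := 1 + 3 * (D * c).
have Dc0 : 0 <= D * c by rewrite mulr_ge0.
have Dp0 : 0 <= D * p by rewrite mulr_ge0.
have r1 : 1 <= r by rewrite /r lerDl mulr_ge0.
pose S n := a (n + N)%N + D * p * \sum_(k < N) v (n + k)%N.
have aS n : a (n + N)%N <= S n by rewrite lerDl mulr_ge0// sumr_ge0.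
have key n : (forall k, (k <= n + N)%N -> a k <= S0 * r ^+ n) /\ S n <= S0 * r ^+ n.
  elim: n => [|n [IH1 IH2]].
    by rewrite expr0 mulr1; split=> [k|]; [exact: hinit|exact: hS].
  have rn1 : 1 <= r ^+ n by rewrite exprn_ege1.
  have X1 : 1 <= S0 * r ^+ n by rewrite mulr_ege1.
  have hSn : S n.+1 <= S0 * r ^+ n.+1.
    rewrite exprSr mulrA.
    have h1 := IH1 (n + N)%N (leqnn _).
    have h2 := IH1 n (leq_addr _ _).
    have hr := rec n.
    have e : D * p * (\sum_(k < N) v (n.+1 + k)%N) + D * p * v n =
             D * p * (\sum_(k < N) v (n + k)%N) + D * p * v (n + N)%N.
      rewrite -!mulrDr; congr (_ * _).
      transitivity (\sum_(k < N.+1) v (n + k)%N).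
        rewrite big_ord_recl addn0 addrC; congr (_ + _).
        by apply: eq_bigr => k _; rewrite /bump/= addnA addn1.
      by rewrite big_ord_recr.
    have : S n.+1 <= S n + D * c * (a (n + N)%N + a n + 1).
      by rewrite /S addSn; move: hr e; lra.
    have : D * c * (a (n + N)%N + a n + 1) <= D * c * (3 * (S0 * r ^+ n)).
      by rewrite ler_wpM2l//; lra.
    move: IH2 h1 h2 X1; set X := S0 * r ^+ n; rewrite /r; lra.
  split=> // k; rewrite leq_eqVlt => /predU1P[->|].
    exact: le_trans (aS _) hSn.
  rewrite addSn ltnS => /IH1 /le_trans; apply.
  by rewrite exprS mulrCA ler_peMl//; lra.
by move=> n; apply: (key n).1.
Qed.

End Real.

(** * The one-dimensional normal distribution *)

Section Density.
Import HBNNSimple.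
Local Open Scope ereal_scope.
Context d (T : measurableType d) (R : realType).
Variables (mu nu : {measure set T -> \bar R}) (h : T -> R).
Hypotheses (mh : measurable_fun setT h) (h0 : forall x, (0 <= h x)%R).
Hypothesis nuE : forall A, measurable A -> nu A = \int[mu]_(x in A) (h x)%:E.

Let integral_density_nnsfun (f : {nnsfun T >-> R}) :
  \int[nu]_x (f x)%:E = \int[mu]_x ((f x)%:E * (h x)%:E).
Proof.
have mhE : measurable_fun setT (fun x => (h x)%:E) by exact/measurable_EFinP.
have hE0 x : 0 <= (h x)%:E by rewrite lee_fin.
under [LHS]eq_integral do rewrite fimfunE -fsumEFin//.
rewrite [LHS]ge0_integral_fsum//; last 2 first.
  - by move=> r; exact/measurable_EFinP/measurableT_comp.
  - by move=> n x _; rewrite EFinM nnfun_muleindic_ge0.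
under [RHS]eq_integral.
  move=> x xD; rewrite fimfunE -fsumEFin// ge0_mule_fsuml; last first.
    by move=> r; rewrite EFinM nnfun_muleindic_ge0.
  over.
rewrite [RHS]ge0_integral_fsum//; last 2 first.
  - move=> r; apply: emeasurable_funM => //.
    by apply/measurable_EFinP; apply/measurableT_comp.
  - by move=> n x _; rewrite mule_ge0// nnfun_muleindic_ge0.
apply: eq_fsbigr => r _.
have [r0|r0] := ltP r 0%R.
  rewrite preimage_nnfun0//; under eq_integral do rewrite indic0 mulr0.
  by under [RHS]eq_integral do rewrite indic0 mulr0 mul0e; rewrite !integral0.
under [RHS]eq_integral do rewrite EFinM -muleA.
rewrite ge0_integralZl//; last 2 first.
  - apply: emeasurable_funM => //; exact/measurable_EFinP/measurable_indic.
  - by move=> x _; rewrite mule_ge0// lee_fin.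
rewrite integralZl_indic_nnsfun//; congr (_ * _).
rewrite integral_indic// setIT nuE// [LHS]integral_mkcond.
apply: eq_integral => x _; rewrite patchE indicE.
by case: ifPn => xE; rewrite ?mul1e ?mul0e.
Qed.

(** Approximation by simple functions reduces the claim to the defining
    property of the density. *)
Lemma ge0_integral_density (f : T -> \bar R) :
  measurable_fun setT f -> (forall x, 0 <= f x) ->
  \int[nu]_x f x = \int[mu]_x (f x * (h x)%:E).
Proof.
move=> mf f0.
have mhE : measurable_fun setT (fun x => (h x)%:E) by exact/measurable_EFinP.
have hE0 x : 0 <= (h x)%:E by rewrite lee_fin.
pose f_ := nnsfun_approx measurableT mf.
transitivity (lim (\int[nu]_x (f_ n x)%:E @[n --> \oo])).
  rewrite -monotone_convergence//=.
  - apply: eq_integral => ? /[!inE] xD; apply/esym/cvg_lim => //=.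
    exact: cvg_nnsfun_approx.
  - by move=> n; exact/measurable_EFinP/measurable_funTS.
  - by move=> n ? _; rewrite lee_fin.
  - by move=> ? _ ? ? mn; rewrite lee_fin; exact/lefP/nd_nnsfun_approx.
transitivity (lim (\int[mu]_x ((f_ n x)%:E * (h x)%:E) @[n --> \oo])).
  by apply: congr_lim; apply/funext => n; exact: integral_density_nnsfun.
rewrite -monotone_convergence//=.
- apply: eq_integral => x /[!inE] xD; apply: cvg_lim => //.
  by apply: cvgeZr => //; exact: cvg_nnsfun_approx.
- by move=> n; apply: emeasurable_funM => //; exact/measurable_EFinP/measurable_funTS.
- by move=> n x _; rewrite mule_ge0// lee_fin.
- move=> x _ a b ab; rewrite lee_wpmul2r// lee_fin; exact/lefP/nd_nnsfun_approx.
Qed.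

End Density.

Section Normal.
Context {R : realType}.
Implicit Types s x : R.
Local Notation leb := (@lebesgue_measure R).

Lemma ge0_integral_normal_prob (m s : R) (f : R -> \bar R) :
  measurable_fun setT f -> (forall x, (0 <= f x)%E) ->
  (\int[normal_prob m s]_x f x = \int[leb]_x (f x * (normal_pdf m s x)%:E))%E.
Proof.
move=> mf f0; apply: ge0_integral_density => //.
- exact: measurable_normal_pdf.
- exact: normal_pdf_ge0.
Qed.

Lemma normal_pdfN s x : s != 0 -> normal_pdf 0 s (- x) = normal_pdf 0 s x.
Proof.
by move=> s0; rewrite normal_pdfE// /normal_fun !subr0 sqrrN.
Qed.

Lemma normal_probN s (B : set R) : s != 0 -> measurable B ->
  normal_prob 0 s (-%R @^-1` B) = normal_prob 0 s B.
Proof.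
move=> s0 mB; rewrite /normal_prob.
have mN : measurable_fun setT (-%R : R -> measurableTypeR R) by exact: oppr_measurable.
rewrite [RHS](eq_measure_integral (pushforward leb (-%R : R -> measurableTypeR R))); last first.
  by move=> A mA _; exact/esym/lebesgue_measureN.
rewrite ge0_integral_pushforward//=.
- by apply: eq_integral => x _; rewrite normal_pdfN.
- apply/measurable_EFinP/measurable_funTS; exact: measurable_normal_pdf.
- by move=> y _; rewrite lee_fin normal_pdf_ge0.
Qed.

Lemma normal_peakZ (a s : R) : 0 < a -> 0 < s ->
  normal_peak (a * s) = a^-1 * normal_peak s.
Proof.
move=> a0 s0; rewrite /normal_peak exprMn -mulrA -mulrnAr sqrtrM ?sqr_ge0//.
by rewrite sqrtr_sqr gtr0_norm// invfM.
Qed.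

(** Exponential moments of a Gaussian are read off a wider Gaussian, whose total
    mass is known; this replaces the computation of moments by parts. *)
Lemma normal_compare (a s x : R) : 1 < a -> 0 < s ->
  expR (x ^+ 2 * (1 - a ^- 2) / (2 * s ^+ 2)) * normal_pdf 0 s x =
  a * normal_pdf 0 (a * s) x.
Proof.
move=> a1 s0; have a0 : 0 < a by lra.
rewrite !normal_pdfE ?gt_eqF ?mulr_gt0// normal_peakZ//.
rewrite /normal_fun subr0 -[in RHS]mulrA mulVKf ?gt_eqF// mulrCA -expRD.
congr (_ * expR _); field; rewrite ?gt_eqF//.
Qed.

Lemma measurable_EFin_normal_pdf s :
  measurable_fun setT (fun x : R => (normal_pdf 0 s x)%:E).
Proof. by apply/measurable_EFinP; exact: measurable_normal_pdf. Qed.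

Lemma EFin_normal_pdf_ge0 s x : (0 <= (normal_pdf 0 s x)%:E)%E.
Proof. by rewrite lee_fin normal_pdf_ge0. Qed.

Lemma integral_normal_pdfZ c s : 0 <= c ->
  (\int[leb]_x (c%:E * (normal_pdf 0 s x)%:E))%E = c%:E.
Proof.
move=> c0; rewrite ge0_integralZl//.
- by rewrite integral_normal_pdf mule1.
- exact: measurable_EFin_normal_pdf.
- by move=> x _; exact: EFin_normal_pdf_ge0.
Qed.

(** Since [1 + y <= expR y], comparison with the standard deviation [a * s]
    gives [1 + c * E x^2 <= a] with [c = (1 - a^-2) / (2 s^2)]; letting [a] tend
    to [1] yields the sharp bound. *)
Lemma normal_var_le s : 0 < s ->
  (\int[normal_prob 0 s]_x (x ^+ 2)%:E <= (s ^+ 2)%:E)%E.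
Proof.
move=> s0.
rewrite ge0_integral_normal_prob; last 2 first.
- by apply/measurable_EFinP; exact: exprn_measurable.
- by move=> x; rewrite lee_fin sqr_ge0.
set I := (X in (X <= _)%E).
have I0 : (0 <= I)%E.
  by apply: integral_ge0 => x _; rewrite -EFinM lee_fin mulr_ge0 ?sqr_ge0 ?normal_pdf_ge0.
have mx2 : measurable_fun setT (fun x : R => (x ^+ 2)%:E * (normal_pdf 0 s x)%:E)%E.
  apply: emeasurable_funM; apply/measurable_EFinP; first exact: exprn_measurable.
  exact: measurable_normal_pdf.
have key (a : R) : 1 < a -> (1 + (((1 - a ^- 2) / (2 * s ^+ 2))%:E * I) <= a%:E)%E.
  move=> a1; have a0 : 0 < a by lra.
  have c0 : 0 <= (1 - a ^- 2) / (2 * s ^+ 2).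
    apply: divr_ge0; last by rewrite mulr_ge0 ?sqr_ge0.
    rewrite subr_ge0 invf_le1 ?exprn_gt0//.
    by rewrite exprn_ege1// ltW.
  rewrite -[in leLHS](@integral_normal_pdf R 0 s) /I -ge0_integralZl//; last first.
    by move=> x _; rewrite -EFinM lee_fin mulr_ge0 ?sqr_ge0 ?normal_pdf_ge0.
  rewrite -ge0_integralD//; last 4 first.
  - by move=> x _; exact: EFin_normal_pdf_ge0.
  - exact: measurable_EFin_normal_pdf.
  - by move=> x _; rewrite -!EFinM lee_fin mulr_ge0// mulr_ge0 ?sqr_ge0 ?normal_pdf_ge0.
  - by apply: emeasurable_funM => //.
  apply: (@le_trans _ _ (\int[leb]_x (a%:E * (normal_pdf 0 (a * s) x)%:E))%E); last first.
    by rewrite integral_normal_pdfZ// ltW.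
  apply: ge0_le_integral => //.
  - move=> x _; rewrite -!EFinM -EFinD lee_fin addr_ge0 ?normal_pdf_ge0//.
    by rewrite mulr_ge0// mulr_ge0 ?sqr_ge0 ?normal_pdf_ge0.
  - apply: emeasurable_funD; first exact: measurable_EFin_normal_pdf.
    by apply: emeasurable_funM.
  - by apply: emeasurable_funM => //; exact: measurable_EFin_normal_pdf.
  move=> x _; rewrite -!EFinM -EFinD lee_fin -normal_compare//.
  rewrite mulrA -[X in X + _]mul1r -mulrDl ler_wpM2r ?normal_pdf_ge0//.
  apply: le_trans (expR_ge1Dx _).
  by rewrite lerD2l [leLHS]mulrC mulrA.
have Ifin : I \is a fin_num.
  rewrite ge0_fin_numE// ltNge; apply/negP; rewrite leye_eq => /eqP Iy.
  have := key 2 ltac:(lra); rewrite Iy gt0_muley; first by rewrite addey.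
  rewrite lte_fin divr_gt0 ?mulr_gt0 ?exprn_gt0//.
  by rewrite subr_gt0 invf_lt1 ?exprn_gt0// -natrX ltr1n.
rewrite -(fineK Ifin) lee_fin.
set J := fine I.
have J0 : 0 <= J by exact: fine_ge0.
apply/ler_addgt0Pl => e e0.
have s20 : 0 < s ^+ 2 by rewrite exprn_gt0.
(* With a = 1 + b the bound reads E x^2 <= (1 + b)^2 s^2, which is at most
   (1 + 3 b) s^2 when b <= 1. *)
pose b := Num.min 1 (e / (3 * s ^+ 2)).
have b0 : 0 < b by rewrite lt_min ltr01 divr_gt0 ?mulr_gt0.
have b1 : b <= 1 by rewrite ge_min lexx.
have be : 3 * b * s ^+ 2 <= e.
  have : b <= e / (3 * s ^+ 2) by rewrite ge_min lexx orbT.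
  by rewrite ler_pdivlMr ?mulr_gt0// mulrCA mulrA.
have a1 : 1 < 1 + b by lra.
have a10 : 0 < 1 + b by lra.
have := key _ a1; rewrite -(fineK Ifin) -/J -EFinM -EFinD lee_fin => h.
have h2 : J <= (1 + b) ^+ 2 * s ^+ 2.
  have e1 : (1 - (1 + b) ^- 2) / (2 * s ^+ 2) = b * ((2 + b) / (2 * ((1 + b) ^+ 2 * s ^+ 2))).
    by field; rewrite ?gt_eqF//; lra.
  have X0 : 0 < (1 + b) ^+ 2 * s ^+ 2 by rewrite mulr_gt0// exprn_gt0//; lra.
  rewrite e1 in h.
  have {}h : (2 + b) / (2 * ((1 + b) ^+ 2 * s ^+ 2)) * J <= 1.
    by rewrite -(ler_pM2l b0); lra.
  have {}h : (2 + b) * J <= 2 * ((1 + b) ^+ 2 * s ^+ 2).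
    rewrite -[leRHS]mul1r -ler_pdivrMr ?mulr_gt0//.
    by rewrite mulrAC.
  have : 0 <= b * J by rewrite mulr_ge0// ltW.
  nra.
apply: (le_trans h2).
nra.
Qed.

(** The same comparison with [a = 2], the power being absorbed by the
    exponential through [y ^+ n <= n! * expR y]. *)
Lemma normal_moment_le n s : 0 < s ->
  (\int[normal_prob 0 s]_x (x ^+ (2 * n))%:E <=
     (2 * 8 ^+ n * n`!%:R * s ^+ (2 * n))%:E)%E.
Proof.
move=> s0.
have m1 : measurable_fun setT (fun x : R => (x ^+ (2 * n))%:E).
  by apply/measurable_EFinP; exact: exprn_measurable.
have p0 x : 0 <= x ^+ (2 * n) by rewrite exprM exprn_ge0 ?sqr_ge0.
rewrite ge0_integral_normal_prob//.
pose c := 2 * 8 ^+ n * n`!%:R * s ^+ (2 * n).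
have c0 : 0 <= c by rewrite !mulr_ge0 ?exprn_ge0// ltW.
apply: (@le_trans _ _ (\int[leb]_x (c%:E * (normal_pdf 0 (2 * s) x)%:E))%E); last first.
  by rewrite integral_normal_pdfZ.
apply: ge0_le_integral => //.
- by move=> x _; rewrite -EFinM lee_fin mulr_ge0 ?normal_pdf_ge0.
- apply: emeasurable_funM => //; exact: measurable_EFin_normal_pdf.
- by apply: emeasurable_funM => //; exact: measurable_EFin_normal_pdf.
move=> x _; rewrite -!EFinM lee_fin.
have -> : c * normal_pdf 0 (2 * s) x =
    8 ^+ n * n`!%:R * s ^+ (2 * n) * (2 * normal_pdf 0 (2 * s) x).
  by rewrite /c; ring.
rewrite -normal_compare//; last lra.
rewrite mulrA ler_wpM2r ?normal_pdf_ge0//.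
set y := x ^+ 2 * (1 - 2 ^- 2) / (2 * s ^+ 2).
have y0 : 0 <= y.
  apply: divr_ge0; first rewrite mulr_ge0 ?sqr_ge0//.
    by rewrite subr_ge0 invf_le1 ?exprn_gt0// exprn_ege1//; lra.
  by rewrite mulr_ge0 ?sqr_ge0.
have hx : x ^+ (2 * n) <= (8 * s ^+ 2 * y) ^+ n.
  have y8 : 0 <= 8 * s ^+ 2 * y by rewrite mulr_ge0// mulr_ge0 ?sqr_ge0.
  rewrite exprM; apply: lerXn2r; rewrite ?nnegrE ?sqr_ge0//.
  have -> : 8 * s ^+ 2 * y = 3 * x ^+ 2 by rewrite /y; field; rewrite gt_eqF.
  by have := sqr_ge0 x; lra.
apply: (le_trans hx).
have -> : (8 * s ^+ 2 * y) ^+ n = 8 ^+ n * s ^+ (2 * n) * y ^+ n.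
  by rewrite exprM -!exprMn.
have -> : 8 ^+ n * n`!%:R * s ^+ (2 * n) * expR y =
          8 ^+ n * s ^+ (2 * n) * (n`!%:R * expR y) by ring.
rewrite ler_wpM2l//; first by rewrite mulr_ge0 ?exprn_ge0// ltW.
rewrite -ler_pdivrMl ?ltr0n ?fact_gt0// mulrC.
case: n {m1 p0 c c0 hx} => [|n]; first by rewrite expr0 fact0 divr1 -expR0 ler_expR.
by apply: le_trans (expR_ge1Dxn n y0); rewrite lerDr.
Qed.
End Normal.

(** * Vectors with independent normal coordinates *)

(** Boxes generate the product sigma-algebra in a form that matches the law of
    the increments of a Brownian motion, which is only given on boxes. *)
Definition boxes (R : realType) m : set (set 'cV[R]_m) :=
  [set A | exists B : 'I_m -> set R,
    (forall i, measurable (B i)) /\ A = [set v : 'cV[R]_m | forall i, B i (v i 0)]].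

Definition boxT (R : realType) m := g_sigma_algebraType (@boxes R m).
HB.instance Definition _ (R : realType) m := Measurable.on (boxT R m).

Definition iid_normal (R : realType) m (nu : set (boxT R m) -> \bar R) (s : R) :=
  forall B : 'I_m -> set R, (forall i, measurable (B i)) ->
  nu [set v : 'cV[R]_m | forall i, B i (v i 0)] =
    (\prod_(i < m) normal_prob 0 s (B i))%E.

Section Boxes.
Context {R : realType} {m : nat}.
Local Notation boxT := (boxT R m).

Lemma setI_closed_boxes : setI_closed (@boxes R m).
Proof.
move=> _ _ [A [mA ->]] [B [mB ->]]; exists (fun i => A i `&` B i); split.
  by move=> i; exact: measurableI.
apply/seteqP; split => [v [hA hB] i|v h]; first by split; [exact: hA|exact: hB].
by split => i; have [] := h i.
Qed.

Lemma boxes_setT : @boxes R m setT.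
Proof. by exists (fun=> setT); split => //; apply/seteqP; split. Qed.

Lemma measurable_box (B : 'I_m -> set R) : (forall i, measurable (B i)) ->
  measurable [set v : boxT | forall i, B i (v i 0)].
Proof. by move=> mB; apply: sub_sigma_algebra; exists B. Qed.

Lemma measurable_coord i : measurable_fun setT (fun v : boxT => v i 0).
Proof.
move=> _ B mB; rewrite setTI.
rewrite (_ : _ @^-1` _ = [set v : boxT | forall j, (if j == i then B else setT) (v j 0)]).
  by apply: (measurable_box (B := fun j => if j == i then B else setT)) => j; case: ifP.
apply/seteqP; split => [v Bv j|v /(_ i)]; last by rewrite eqxx.
by case: eqP => [->|].
Qed.

Lemma measurable_fun_boxT d (T : measurableType d) (Y : T -> boxT) :
  (forall i, measurable_fun setT (fun w => Y w i 0)) -> measurable_fun setT Y.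
Proof.
move=> mY; apply: (@measurability _ _ T boxT setT Y (@boxes R m)) => // _ [_ [B [mB ->]] <-].
rewrite setTI (_ : _ @^-1` _ = \bigcap_(i in [set: 'I_m]) [set w | B i (Y w i 0)]).
  apply: fin_bigcap_measurable => // i _; rewrite -[X in measurable X]setTI.
  exact: mY.
apply/seteqP; split => [w h i _|w h i]; first exact: h.
exact: (h i).
Qed.

Definition flip (S : pred 'I_m) (v : 'cV[R]_m) : 'cV[R]_m :=
  \col_i (if S i then - v i 0 else v i 0).

Lemma measurable_flip S : measurable_fun setT (flip S : boxT -> boxT).
Proof.
apply: measurable_fun_boxT => i.
have [Si|Si] := boolP (S i).
  rewrite (_ : (fun w => _) = (-%R \o (fun v : boxT => v i 0))).
    by apply: measurableT_comp => //; exact: measurable_coord.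
  by apply/funext => v /=; rewrite mxE Si.
rewrite (_ : (fun w => _) = (fun v : boxT => v i 0)); first exact: measurable_coord.
by apply/funext => v /=; rewrite mxE (negbTE Si).
Qed.

Variables (nu : probability boxT R) (s : R).
Hypothesis s0 : 0 < s.
Hypothesis nu_normal : iid_normal nu s.

Let nuE (B : 'I_m -> set R) : (forall i, measurable (B i)) ->
  nu [set v : 'cV[R]_m | forall i, B i (v i 0)] =
    (\prod_(i < m) normal_prob 0 s (B i))%E.
Proof. exact: nu_normal. Qed.

(** The two laws agree on boxes by the symmetry of each marginal, and boxes form
    a pi-system generating the sigma-algebra. *)
Lemma ge0_integral_flip S (psi : boxT -> \bar R) :
  measurable_fun setT psi -> (forall v, (0 <= psi v)%E) ->
  (\int[nu]_v psi (flip S v) = \int[nu]_v psi v)%E.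
Proof.
move=> mpsi psi0.
have mF := measurable_flip S.
transitivity (\int[pushforward nu (flip S : boxT -> boxT)]_v psi v)%E.
  by rewrite ge0_integral_pushforward.
apply: eq_measure_integral => A mA _.
have cover : \bigcup_(k : nat) (setT : set boxT) = setT.
  by apply/seteqP; split => // x _; exists 0.
have fin (k : nat) : (pushforward nu (flip S : boxT -> boxT) setT < +oo)%E.
  by apply: le_lt_trans (probability_le1 nu _) (ltry _) => //; rewrite preimage_setT.
have eqb B : @boxes R m B -> pushforward nu (flip S : boxT -> boxT) B = nu B.
  move=> [D [mD ->]]; rewrite nuE// /pushforward.
  have -> : flip S @^-1` [set v : 'cV[R]_m | forall i, D i (v i 0)] =
     [set v : 'cV[R]_m | forall i, (if S i then -%R @^-1` D i else D i) (v i 0)].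
    by apply/seteqP; split => v /= h i; move: (h i); rewrite mxE; case: ifP.
  rewrite (nuE (B := fun i => if S i then -%R @^-1` D i else D i)).
    apply: eq_bigr => i _; case: ifP => // _.
    by rewrite normal_probN// gt_eqF.
  move=> i; case: ifP => // _; rewrite -[X in measurable X]setTI.
  exact: oppr_measurable.
exact: (@measure_unique _ R boxT (@boxes R m) (fun=> setT) erefl
  setI_closed_boxes (fun=> boxes_setT) cover _ nu eqb fin A mA).
Qed.

Lemma ge0_integral_coord i (phi : R -> \bar R) :
  measurable_fun setT phi -> (forall x, (0 <= phi x)%E) ->
  (\int[nu]_v phi (v i 0%R) = \int[normal_prob 0 s]_x phi x)%E.
Proof.
move=> mphi phi0.
have mF : measurable_fun setT ((fun v : boxT => v i 0) : boxT -> measurableTypeR R)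
  := measurable_coord i.
transitivity (\int[pushforward nu ((fun v : boxT => v i 0%R) : boxT -> measurableTypeR R)]_x phi x)%E.
  by rewrite ge0_integral_pushforward.
have e A : measurable A -> pushforward nu (fun v : boxT => v i 0) A = normal_prob 0 s A.
  move=> mA; rewrite /pushforward.
  have -> : (fun v : boxT => v i 0) @^-1` A =
      [set v : 'cV[R]_m | forall j, (if j == i then A else setT) (v j 0)].
    apply/seteqP; split => [v Bv j|v /(_ i)]; last by rewrite eqxx.
    by case: eqP => [->|].
  rewrite (nuE (B := fun j => if j == i then A else setT)).
    rewrite (bigD1 i)//= eqxx big1 ?mule1// => j /negbTE ->.
    exact: probability_setT.
  by move=> j; case: ifP.
by apply: eq_measure_integral => A mA _; first [exact: e | exact/esym/e].
Qed.

Lemma measurable_lin (a : 'I_m -> R) (r : seq 'I_m) :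
  measurable_fun setT (fun v : boxT => \sum_(j <- r) a j * v j 0).
Proof.
apply: measurable_sum => j; apply: measurable_funM => //; exact: measurable_coord.
Qed.

(** Flipping the sign of the first coordinate averages the cross term away, so
    that the coordinates can be removed one at a time. *)
Lemma integral_lin_sq_le (a : 'I_m -> R) (r : seq 'I_m) : uniq r ->
  (\int[nu]_v ((\sum_(j <- r) a j * v j 0) ^+ 2)%:E <=
   (s ^+ 2 * \sum_(j <- r) a j ^+ 2)%:E)%E.
Proof.
elim: r => [_|j r IH /= /andP[jr ur]].
  under eq_integral do rewrite big_nil expr0n/=.
  by rewrite integral0 big_nil mulr0.
pose A (v : boxT) := a j * v j 0.
pose B (v : boxT) := \sum_(k <- r) a k * v k 0.
have mA : measurable_fun setT A by apply: measurable_funM => //; exact: measurable_coord.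
have mB : measurable_fun setT B by exact: measurable_lin.
have mE (h : boxT -> R) : measurable_fun setT h -> measurable_fun setT (fun v => (h v ^+ 2)%:E).
  by move=> mh; apply/measurable_EFinP; exact: measurable_funX.
have mAB : measurable_fun setT (fun v : boxT => ((A v + B v) ^+ 2)%:E).
  by apply: mE; exact: measurable_funD.
have mBA : measurable_fun setT (fun v : boxT => ((- A v + B v) ^+ 2)%:E).
  by apply: mE; apply: measurable_funD => //; exact: measurableT_comp.
under eq_integral do rewrite big_cons -/(A _) -/(B _).
have sq0 (x : R) : (0 <= (x ^+ 2)%:E)%E by rewrite lee_fin sqr_ge0.
have flipE : (\int[nu]_v ((- A v + B v) ^+ 2)%:E = \int[nu]_v ((A v + B v) ^+ 2)%:E)%E.
  rewrite -(@ge0_integral_flip (pred1 j) (fun v => ((A v + B v) ^+ 2)%:E))//.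
  apply: eq_integral => v _; congr (_ ^+ 2)%:E; rewrite /A /B mxE/= eqxx mulrN; congr (_ + _).
  apply: eq_big_seq => k kr; rewrite mxE/=; case: eqP => // kj.
  by rewrite kj (negbTE jr) in kr.
have h2 : (2%:E * \int[nu]_v ((A v + B v) ^+ 2)%:E =
     2%:E * (\int[nu]_v (A v ^+ 2)%:E + \int[nu]_v (B v ^+ 2)%:E))%E.
  rewrite -ge0_integralD//; [|exact: mE|exact: mE].
  rewrite -[in RHS]ge0_integralZl//; first last.
  - by move=> v _; exact: adde_ge0.
  - by apply: emeasurable_funD; exact: mE.
  rewrite -[2%:E]/((1 + 1)%:E) EFinD ge0_muleDl// mul1e -{2}flipE -ge0_integralD//.
  apply: eq_integral => v _; rewrite -!EFinD -EFinM; congr EFin.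
  by ring.
have {h2} -> : (\int[nu]_v ((A v + B v) ^+ 2)%:E =
    \int[nu]_v (A v ^+ 2)%:E + \int[nu]_v (B v ^+ 2)%:E)%E.
  move: h2 => /(congr1 (fun x => (2^-1)%:E * x)%E).
  by rewrite !muleA -EFinM mulVf// !mul1e.
rewrite big_cons mulrDr EFinD leeD//; last exact: IH.
under eq_integral do rewrite /A exprMn EFinM.
rewrite (@ge0_integral_coord j (fun x => (a j ^+ 2)%:E * (x ^+ 2)%:E))%E; first last.
- by move=> x; rewrite -EFinM lee_fin mulr_ge0 ?sqr_ge0.
- by apply: emeasurable_funM => //; apply/measurable_EFinP; exact: exprn_measurable.
rewrite ge0_integralZl//.
- have -> : s ^+ 2 * a j ^+ 2 = a j ^+ 2 * s ^+ 2 by rewrite mulrC.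
  rewrite [leRHS]EFinM; apply: lee_wpmul2l; last exact: normal_var_le.
  by rewrite lee_fin sqr_ge0.
- by apply/measurable_EFinP; exact: exprn_measurable.
Qed.

End Boxes.

(** * Euclidean and Hilbert-Schmidt norms *)

Section EuclideanNorm.
Context {R : realType}.

Lemma hsnorm_ge0 a b (A : 'M[R]_(a, b)) : 0 <= hsnorm A.
Proof. exact: sqrtr_ge0. Qed.

Lemma hsnorm_sqr a b (A : 'M[R]_(a, b)) :
  hsnorm A ^+ 2 = \sum_i \sum_j A i j ^+ 2.
Proof.
by rewrite sqr_sqrtr// sumr_ge0// => i _; rewrite sumr_ge0// => j _; exact: sqr_ge0.
Qed.

Lemma hsnorm_cV_sqr a (x : 'cV[R]_a) : hsnorm x ^+ 2 = \sum_i x i 0 ^+ 2.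
Proof. by rewrite hsnorm_sqr; apply: eq_bigr => i _; rewrite big_ord1. Qed.

Lemma hsnormZ a b c (A : 'M[R]_(a, b)) : hsnorm (c *: A) = `|c| * hsnorm A.
Proof.
rewrite /hsnorm -sqrtr_sqr -sqrtrM ?sqr_ge0// mulr_sumr; congr Num.sqrt.
apply: eq_bigr => i _; rewrite mulr_sumr; apply: eq_bigr => j _.
by rewrite mxE exprMn.
Qed.

Lemma entry_le_hsnorm a b (A : 'M[R]_(a, b)) i j : `|A i j| <= hsnorm A.
Proof.
rewrite -ler_sqr ?nnegrE ?hsnorm_ge0// real_normK ?num_real// hsnorm_sqr.
rewrite (bigD1 i)//= (bigD1 j)//= -addrA lerDl addr_ge0 ?sumr_ge0// => k _.
  exact: sqr_ge0.
by rewrite sumr_ge0// => l _; exact: sqr_ge0.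
Qed.

Lemma cauchy_schwarz_sum n (a b : 'I_n -> R) :
  (\sum_i a i * b i) ^+ 2 <= (\sum_i a i ^+ 2) * (\sum_i b i ^+ 2).
Proof.
have h : 0 <= \sum_i \sum_j (a i * b j - a j * b i) ^+ 2.
  by rewrite sumr_ge0// => i _; rewrite sumr_ge0// => j _; exact: sqr_ge0.
have e : \sum_i \sum_j (a i * b j - a j * b i) ^+ 2 =
    2 * ((\sum_i a i ^+ 2) * (\sum_i b i ^+ 2)) - 2 * (\sum_i a i * b i) ^+ 2.
  transitivity (\sum_i \sum_j (a i ^+ 2 * b j ^+ 2 + a j ^+ 2 * b i ^+ 2
     - 2 * ((a i * b i) * (a j * b j)))).
    by apply: eq_bigr => i _; apply: eq_bigr => j _; ring.
  under eq_bigr do rewrite big_split big_split/= sumrN -!mulr_sumr -mulr_suml.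
  rewrite !big_split/= sumrN -!mulr_sumr -!mulr_suml; ring.
by rewrite e in h; lra.
Qed.

Lemma dotv_sqr_le a (x y : 'cV[R]_a) :
  dotv x y ^+ 2 <= hsnorm x ^+ 2 * hsnorm y ^+ 2.
Proof. by rewrite !hsnorm_cV_sqr; exact: cauchy_schwarz_sum. Qed.

Lemma normr_dotv_le a (x y : 'cV[R]_a) : `|dotv x y| <= hsnorm x * hsnorm y.
Proof.
rewrite -ler_sqr ?nnegrE ?mulr_ge0 ?hsnorm_ge0//.
by rewrite real_normK ?num_real// exprMn dotv_sqr_le.
Qed.

Lemma hsnormD_sqr a (x y : 'cV[R]_a) :
  hsnorm (x + y) ^+ 2 = hsnorm x ^+ 2 + 2 * dotv x y + hsnorm y ^+ 2.
Proof.
rewrite !hsnorm_cV_sqr /dotv mulr_sumr -!big_split/=; apply: eq_bigr => i _.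
by rewrite mxE; ring.
Qed.

Lemma dotvZl a c (x y : 'cV[R]_a) : dotv (c *: x) y = c * dotv x y.
Proof. by rewrite /dotv mulr_sumr; apply: eq_bigr => i _; rewrite mxE mulrA. Qed.

Lemma dotvZr a c (x y : 'cV[R]_a) : dotv x (c *: y) = c * dotv x y.
Proof. by rewrite /dotv mulr_sumr; apply: eq_bigr => i _; rewrite mxE mulrCA. Qed.

Lemma dotvNr a (x y : 'cV[R]_a) : dotv x (- y) = - dotv x y.
Proof. by rewrite -scaleN1r dotvZr mulN1r. Qed.

Lemma hsnormN a b (A : 'M[R]_(a, b)) : hsnorm (- A) = hsnorm A.
Proof. by rewrite -scaleN1r hsnormZ normrN1 mul1r. Qed.

Lemma hsnorm_mulmx_le a b (G : 'M[R]_(a, b)) (v : 'cV[R]_b) :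
  hsnorm (G *m v) ^+ 2 <= hsnorm G ^+ 2 * hsnorm v ^+ 2.
Proof.
rewrite hsnorm_cV_sqr hsnorm_sqr mulr_suml ler_sum// => i _.
by rewrite mxE hsnorm_cV_sqr; exact: cauchy_schwarz_sum.
Qed.

End EuclideanNorm.

(** * One step of the scheme from a fixed state *)

Section SymmetricIntegral.
Lemma integral_cst_prob (R : realType) d (T : measurableType d)
    (nu : probability T R) (r : R) : (\int[nu]_v r%:E = r%:E)%E.
Proof.
rewrite (integral_cst nu measurableT) -[RHS]mule1; congr (_ * _)%E.
exact: probability_setT.
Qed.

Let shift_sym_bound (R : realType) (x y z t a b c e : R) : x + y <= 2 * (a + b * z + c * t) ->
  x + y + 2 * e <= 2 * (a + e) + 2 * b * z + 2 * c * t.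
Proof. lra. Qed.

Let unshift_sym_bound (R : realType) (i a b c e q m : R) :
  i + i + 2 * e <= 2 * (a + e) + 2 * b * q + 2 * c * m -> i <= a + b * q + c * m.
Proof. lra. Qed.

Local Open Scope ereal_scope.
Context {R : realType} {m : nat}.
Local Notation boxT := (boxT R m).
Variables (nu : probability boxT R) (s : R).
Hypothesis s0 : (0 < s)%R.
Hypothesis nuE : iid_normal nu s.

(** A pointwise bound on [Psi v + Psi (- v)] suffices.  The constant [a] may be
    negative, so both sides are shifted by [|a|] to integrate nonnegative functions
    only. *)
Lemma integral_sym_le (Psi Q M : boxT -> R) (a b c q' m' : R) :
  measurable_fun setT Psi -> measurable_fun setT Q -> measurable_fun setT M ->
  (forall v, 0 <= Psi v)%R -> (forall v, 0 <= Q v)%R -> (forall v, 0 <= M v)%R ->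
  (0 <= b)%R -> (0 <= c)%R ->
  \int[nu]_v (Q v)%:E <= q'%:E -> \int[nu]_v (M v)%:E <= m'%:E ->
  (forall v : boxT, Psi v + Psi (- v : 'cV[R]_m) <= 2 * (a + b * Q v + c * M v))%R ->
  \int[nu]_v (Psi v)%:E <= (a + b * q' + c * m')%:E.
Proof.
move=> mP mQ mM P0 Q0 M0 b0 c0 Qq Mm hP.
have mE (h : boxT -> R) : measurable_fun setT h -> measurable_fun setT (fun v => (h v)%:E).
  by move=> mh; exact/measurable_EFinP.
have cst (r : R) : \int[nu]_v r%:E = r%:E by exact: integral_cst_prob.
set I := \int[nu]_v (Psi v)%:E.
have I0 : 0 <= I by apply: integral_ge0 => v _; rewrite lee_fin.
pose flT := @flip R m predT.
have mPf : measurable_fun setT (fun v : boxT => Psi (flT v)).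
  have mflT : measurable_fun setT (flT : boxT -> boxT) by exact: measurable_flip.
  exact: (measurableT_comp mP mflT).
have flipE : \int[nu]_v (Psi (flT v))%:E = I.
  exact: (@ge0_integral_flip _ _ nu s s0 nuE predT (fun v => (Psi v)%:E) (mE _ mP)
    (fun v => P0 v)).
have flTE v : flT v = (- v)%R by apply/matrixP => i j; rewrite !mxE (ord1 j).
pose e : R := `|a|%R.
have ege0 : (0 <= e)%R by exact: normr_ge0.
have L : I + I + (2 * e)%:E <= (2 * (a + e))%:E + (2 * b)%:E * \int[nu]_v (Q v)%:E
    + (2 * c)%:E * \int[nu]_v (M v)%:E.
  rewrite -{2}flipE -ge0_integralD//; [|by move=> v _; rewrite lee_fin|exact: mE
    |by move=> v _; rewrite lee_fin|exact: mE].
  rewrite -[X in X + _ + _ >= _]cst -[X in _ + X <= _]cst.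
  rewrite -!ge0_integralZl//; [|exact: mE|by move=> v _; rewrite lee_fin
    |by rewrite lee_fin mulr_ge0|exact: mE|by move=> v _; rewrite lee_fin
    |by rewrite lee_fin mulr_ge0].
  have ae0 : (0 <= 2 * (a + e))%R.
    by rewrite mulr_ge0// /e; have := ler_norm (- a); rewrite normrN; lra.
  have mQb : measurable_fun setT (fun v : boxT => (2 * b)%:E * (Q v)%:E).
    by apply: emeasurable_funM => //; exact: mE.
  have mMc : measurable_fun setT (fun v : boxT => (2 * c)%:E * (M v)%:E).
    by apply: emeasurable_funM => //; exact: mE.
  have Qb0 v : 0 <= (2 * b)%:E * (Q v)%:E by rewrite -EFinM lee_fin !mulr_ge0.
  have Mc0 v : 0 <= (2 * c)%:E * (M v)%:E by rewrite -EFinM lee_fin !mulr_ge0.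
  have mPP : measurable_fun setT (fun v => (Psi v)%:E + (Psi (flT v))%:E).
    by apply: emeasurable_funD; exact: mE.
  have PP0 v : 0 <= (Psi v)%:E + (Psi (flT v))%:E by rewrite -EFinD lee_fin addr_ge0.
  have cst0 (v : boxT) : 0 <= (2 * (a + e))%:E by rewrite lee_fin.
  rewrite -[X in _ <= X + _]ge0_integralD// -[leRHS]ge0_integralD//; last 2 first.
  - by move=> v _; exact: adde_ge0.
  - by apply: emeasurable_funD.
  have e0 (v : boxT) : 0 <= (2 * e)%:E by rewrite lee_fin mulr_ge0.
  rewrite -[leLHS]ge0_integralD//; last by move=> v _; exact: e0.
  apply: ge0_le_integral => //.
  - by move=> v _; rewrite adde_ge0// lee_fin mulr_ge0.
  - by apply: emeasurable_funD.
  - by apply: emeasurable_funD => //; apply: emeasurable_funD.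
  move=> v _; rewrite -!EFinM -!EFinD lee_fin flTE.
  exact: shift_sym_bound (hP v).
have {}L : I + I + (2 * e)%:E <= (2 * (a + e) + 2 * b * q' + 2 * c * m')%:E.
  apply: (le_trans L); rewrite !EFinD !(EFinM (2 * _)).
  by rewrite leeD ?leeD ?lee_wpmul2l// lee_fin mulr_ge0.
have Ifin : I \is a fin_num.
  rewrite ge0_fin_numE// ltNge; apply/negP; rewrite leye_eq => /eqP Iy.
  by move: L; rewrite Iy.
by move: L; rewrite -(fineK Ifin) -!EFinD !lee_fin; exact: unshift_sym_bound.
Qed.

End SymmetricIntegral.

Section NormalMoments.
Context {R : realType}.

(** Reduces the moments of a sum to those of its terms, through the maximum of
    [1] and the terms. *)
Lemma expr_sum_le m N (x : 'I_m -> R) : (forall j, 0 <= x j) ->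
  (1 + \sum_j x j) ^+ N <= m.+1%:R ^+ N * (1 + \sum_j x j ^+ N).
Proof.
move=> x0; pose y := \big[Num.max/1]_j x j.
have xy j : x j <= y by exact: le_bigmax.
have y1 : 1 <= y by exact: bigmax_ge_id.
have h : 1 + \sum_j x j <= m.+1%:R * y.
  rewrite -natr1 mulrDl mul1r addrC lerD//.
  apply: (@le_trans _ _ (\sum_(j < m) y)); first exact: ler_sum.
  by rewrite sumr_const card_ord mulr_natl.
have yN : y ^+ N <= 1 + \sum_j x j ^+ N.
  rewrite /y; apply: (big_ind (fun y => y ^+ N <= 1 + \sum_j x j ^+ N)).
  - by rewrite expr1n lerDl sumr_ge0// => j _; rewrite exprn_ge0.
  - by move=> a b ha hb; case: (leP a b).
  - move=> i _; rewrite (bigD1 i)//= addrCA lerDl addr_ge0// sumr_ge0// => j _.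
    by rewrite exprn_ge0.
apply: (@le_trans _ _ ((m.+1%:R * y) ^+ N)).
  rewrite lerXn2r// nnegrE; first by rewrite addr_ge0// sumr_ge0.
  by rewrite mulr_ge0// (le_trans _ y1).
by rewrite exprMn ler_wpM2l// exprn_ge0.
Qed.

Section Gaussian.
Context {m : nat}.
Local Notation boxT := (boxT R m).
Variables (nu : probability boxT R) (s : R).
Hypothesis s0 : 0 < s.
Hypothesis nuE : iid_normal nu s.

Lemma measurable_mulmx d (G : 'M[R]_(d, m)) i :
  measurable_fun setT (fun v : boxT => (G *m v) i 0).
Proof.
rewrite (_ : (fun v : boxT => _) = (fun v : boxT => \sum_(j <- index_enum 'I_m) G i j * v j 0)).
  exact: measurable_lin.
by apply/funext => v; rewrite mxE.
Qed.

Lemma measurable_hsnorm_sqr d' (T : measurableType d') d (X : T -> 'cV[R]_d) :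
  (forall i, measurable_fun setT (fun w => X w i 0)) ->
  measurable_fun setT (fun w => hsnorm (X w) ^+ 2).
Proof.
move=> mX; rewrite (_ : (fun w => _) = (fun w => \sum_(i <- index_enum 'I_d) X w i 0 ^+ 2)).
  by apply: measurable_sum => i; exact: measurable_funX.
by apply/funext => v; rewrite hsnorm_cV_sqr.
Qed.

Lemma integral_mulmx_sq_le d (G : 'M[R]_(d, m)) :
  (\int[nu]_v (hsnorm (G *m v) ^+ 2)%:E <= (s ^+ 2 * hsnorm G ^+ 2)%:E)%E.
Proof.
pose q i (v : boxT) := ((\sum_(j <- index_enum 'I_m) G i j * v j 0) ^+ 2)%:E.
have -> : (\int[nu]_v (hsnorm (G *m v) ^+ 2)%:E =
    \int[nu]_v \sum_(i <- index_enum 'I_d) q i v)%E.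
  apply: eq_integral => v _; rewrite hsnorm_cV_sqr sumEFin; congr EFin.
  by apply: eq_bigr => i _; rewrite mxE.
have mq i : measurable_fun setT (q i).
  by apply/measurable_EFinP; apply: measurable_funX; exact: measurable_lin.
rewrite ge0_integral_sum//; last by move=> i v _; rewrite lee_fin sqr_ge0.
rewrite hsnorm_sqr mulr_sumr -sumEFin; apply: lee_sum => i _.
by apply: (integral_lin_sq_le s0 nuE (fun j => G i j)); exact: index_enum_uniq.
Qed.

(** A bound, uniform in [s], for the moments of [1 + k * |v / s| ^+ 2] under the
    law of a vector with independent centred normal coordinates. *)
Definition gauss_moment (k : R) N : R :=
  ((1 + k) * m.+1%:R) ^+ N * (1 + m%:R * (2 * 8 ^+ N * N`!%:R)).

Lemma gauss_moment_ge0 k N : 0 <= k -> 0 <= gauss_moment k N.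
Proof.
move=> k0; rewrite mulr_ge0 ?exprn_ge0 ?mulr_ge0 ?addr_ge0//.
Qed.

Lemma integral_moment_le (k : R) N : 0 <= k ->
  (\int[nu]_v ((1 + k * (hsnorm (v : 'cV[R]_m) ^+ 2 / s ^+ 2)) ^+ N)%:E <=
   (gauss_moment k N)%:E)%E.
Proof.
move=> k0.
pose c := ((1 + k) * m.+1%:R) ^+ N.
have c0 : 0 <= c by rewrite exprn_ge0// mulr_ge0// addr_ge0.
pose x (v : boxT) (j : 'I_m) := (v j 0 / s) ^+ 2.
pose h (x : R) := ((x / s) ^+ (2 * N))%:E.
have mh : measurable_fun setT h.
  by apply/measurable_EFinP; apply: measurable_funX; exact: measurable_funM.
have h0 y : (0 <= h y)%E by rewrite lee_fin exprM exprn_ge0// sqr_ge0.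
have mhv j : measurable_fun setT (fun v : boxT => h (v j 0)).
  by apply: (measurableT_comp mh); exact: measurable_coord.
have mv : measurable_fun setT (fun v : boxT => hsnorm (v : 'cV[R]_m) ^+ 2).
  by apply: measurable_hsnorm_sqr => i; exact: measurable_coord.
apply: (@le_trans _ _ (\int[nu]_v (c%:E * (1 + \sum_(j <- index_enum 'I_m) h (v j 0%R))))%E).
  apply: ge0_le_integral => //.
  - move=> v _; rewrite lee_fin exprn_ge0// addr_ge0// mulr_ge0// divr_ge0 ?sqr_ge0//.
  - apply/measurable_EFinP; apply: measurable_funX; apply: measurable_funD => //.
    by apply: measurable_funM => //; exact: measurable_funM.
  - apply: emeasurable_funM => //; apply: emeasurable_funD => //.
    exact: emeasurable_sum.
  move=> v _.
  rewrite sumEFin -EFinD -EFinM lee_fin.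
  have e : hsnorm (v : 'cV[R]_m) ^+ 2 / s ^+ 2 = \sum_j x v j.
    rewrite hsnorm_cV_sqr mulr_suml; apply: eq_bigr => j _.
    by rewrite /x exprMn exprVn.
  have e2 : \sum_j (v j 0 / s) ^+ (2 * N) = \sum_j x v j ^+ N.
    by apply: eq_bigr => j _; rewrite exprM.
  rewrite e e2 /c exprMn -mulrA.
  have X0 : 0 <= \sum_j x v j by rewrite sumr_ge0// => j _; exact: sqr_ge0.
  apply: (@le_trans _ _ (((1 + k) * (1 + \sum_j x v j)) ^+ N)).
    rewrite lerXn2r ?nnegrE ?addr_ge0 ?mulr_ge0 ?addr_ge0//.
    by move: X0; set X := \sum_j _ => X0; nra.
  rewrite exprMn ler_wpM2l ?exprn_ge0 ?addr_ge0//.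
  by apply: expr_sum_le => j; exact: sqr_ge0.
rewrite ge0_integralZl//; last 2 first.
- by apply: emeasurable_funD => //; exact: emeasurable_sum.
- by move=> v _; rewrite adde_ge0// sume_ge0.
rewrite /gauss_moment EFinM lee_wpmul2l//.
rewrite ge0_integralD//; last 2 first.
- by move=> v _; rewrite sume_ge0.
- exact: emeasurable_sum.
rewrite integral_cst_prob EFinD leeD2l// ge0_integral_sum//.
have -> : m%:R * (2 * 8 ^+ N * N`!%:R) = \sum_(j <- index_enum 'I_m) (2 * 8 ^+ N * N`!%:R) :> R.
  by rewrite sumr_const card_ord mulr_natl.
rewrite -sumEFin; apply: lee_sum => j _.
rewrite (ge0_integral_coord nuE j mh)//.
have -> : h = (fun x : R => (s ^- (2 * N))%:E * (x ^+ (2 * N))%:E)%E.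
  by apply/funext => y; rewrite /h -EFinM exprMn exprVn mulrC.
have p0 y : 0 <= y ^+ (2 * N) :> R by rewrite exprM exprn_ge0 ?sqr_ge0.
rewrite ge0_integralZl//; last 3 first.
- by apply/measurable_EFinP; exact: exprn_measurable.
- by move=> y _; rewrite lee_fin.
- by rewrite lee_fin invr_ge0.
apply: (@le_trans _ _ ((s ^- (2 * N))%:E * (2 * 8 ^+ N * N`!%:R * s ^+ (2 * N))%:E)%E).
  by rewrite lee_wpmul2l ?normal_moment_le// lee_fin invr_ge0.
by rewrite -EFinM lee_fin mulrC mulfK// expf_neq0// gt_eqF.
Qed.

End Gaussian.

End NormalMoments.

Section OneStep.
Context {R : realType}.

Lemma sqr_add_le (al be s c k : R) : 0 <= s -> 0 <= c -> 0 <= k -> 0 <= be ->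
  `|al| <= s * c -> be <= s * k ->
  al ^+ 2 + be ^+ 2 <= s ^+ 2 * (c ^+ 2 + 1) * (1 + k) ^+ 2.
Proof.
move=> s0 c0 k0 be0 hal hbe.
have h1 : al ^+ 2 <= s ^+ 2 * c ^+ 2.
  by rewrite -exprMn -real_normK ?num_real// lerXn2r ?nnegrE// mulr_ge0.
have h2 : be ^+ 2 <= s ^+ 2 * k ^+ 2.
  by rewrite -exprMn lerXn2r ?nnegrE// mulr_ge0.
have h3 : 0 <= s ^+ 2 * c ^+ 2 * (2 * k + k ^+ 2).
  by rewrite mulr_ge0 ?sqr_ge0 ?mulr_ge0 ?sqr_ge0// addr_ge0 ?sqr_ge0// mulr_ge0.
have h4 : 0 <= s ^+ 2 * (1 + 2 * k) by rewrite mulr_ge0 ?sqr_ge0// addr_ge0// mulr_ge0.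
move: h1 h2 h3 h4; move: (al ^+ 2) (be ^+ 2) (s ^+ 2) (c ^+ 2) => A B S D; nra.
Qed.

(** One step of length [s ^+ 2] from [z], before truncation, with drift [phi],
    diffusion [G] and Gaussian increment [v].  The two growth conditions say that
    [phi] and [G] may be as large as [s^-1] and [s^(-1/2)]. *)
Definition one_step_bound (m : nat) (p K C : R) := forall (d : nat)
    (nu : probability (boxT R m) R) (s : R) (z phi : 'cV[R]_d) (G : 'M[R]_(d, m)),
  0 < s -> s <= 1 -> iid_normal nu s ->
  s * hsnorm phi <= K * (1 + hsnorm z) ->
  s * hsnorm G ^+ 2 <= K * (1 + hsnorm z) ^+ 2 ->
  (\int[nu]_v ((1 + hsnorm (z + s ^+ 2 *: phi + G *m v) ^+ 2) `^ p)%:E <=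
   ((1 + hsnorm z ^+ 2) `^ p +
    s ^+ 2 * p * ((1 + hsnorm z ^+ 2) `^ (p - 1) *
      (dotv (2 *: z) phi + Num.max (2 * p - 1) 1 * hsnorm G ^+ 2)) +
    C * s ^+ 2 * (1 + hsnorm z ^+ 2) `^ p)%:E)%E.

(** [sym_powR_le] applied with [al], [be], [ga] as in the opening comment. *)
Lemma one_step (p K : R) (m : nat) : 0 < p -> 0 <= K ->
  exists2 C : R, 0 <= C & one_step_bound m p K C.
Proof.
move=> p0 K0.
pose c0 := 4 * K + 2 * K ^+ 2.
have c00 : 0 <= c0 by rewrite addr_ge0 ?mulr_ge0 ?sqr_ge0.
have [n [C1 C10 hC1]] := sym_powR_le p0 c00.
pose M := @gauss_moment R m (2 * K) n.+2.
have M0 : 0 <= M by rewrite gauss_moment_ge0// mulr_ge0.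
exists (2 * p * K ^+ 2 + C1 * (c0 ^+ 2 + 1) * M).
  exact: addr_ge0 (mulr_ge0 (mulr_ge0 (ler0n _ _) (ltW p0)) (sqr_ge0 _))
    (mulr_ge0 (mulr_ge0 C10 (addr_ge0 (sqr_ge0 _) ler01)) M0).
move=> d nu s z phi G s0 s1 nuE hphi hG.
have s0' : 0 <= s := ltW s0.
set Z := hsnorm z; set u := 1 + Z ^+ 2; set kappa := Num.max (2 * p - 1) 1.
have Z0 : 0 <= Z by exact: hsnorm_ge0.
have Z20 : 0 <= Z ^+ 2 by exact: sqr_ge0.
have u1 : 1 <= u by rewrite lerDl.
have u0 : 0 < u by lra.
have k1 : 1 <= kappa by rewrite le_max lexx orbT.
pose Fn := hsnorm phi.
have F0 : 0 <= Fn by exact: hsnorm_ge0.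
rewrite -/Fn -/Z in hphi; rewrite -/Z in hG.
have Zu : (1 + Z) ^+ 2 <= 2 * u by rewrite /u; have := sqr_ge0 (1 - Z); nra.
pose y := z + s ^+ 2 *: phi.
pose al := (2 * s ^+ 2 * dotv z phi + (s ^+ 2 * Fn) ^+ 2) / u.
have ual : u * (1 + al) = 1 + hsnorm y ^+ 2.
  rewrite /y hsnormD_sqr hsnormZ dotvZr ger0_norm ?sqr_ge0// -/Fn -/Z.
  rewrite mulrDr mulr1 /al mulrCA divff ?gt_eqF// mulr1 /u; ring.
have sF2 : (s * Fn) ^+ 2 <= K ^+ 2 * (2 * u).
  apply: (@le_trans _ _ ((K * (1 + Z)) ^+ 2)).
    by rewrite lerXn2r ?nnegrE ?mulr_ge0 ?addr_ge0// ltW.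
  by rewrite exprMn ler_wpM2l ?sqr_ge0.
have hal : `|al| <= s * c0.
  rewrite /al normrM normfV (gtr0_norm u0) ler_pdivrMr//.
  apply: (le_trans (ler_normD _ _)).
  rewrite [X in _ + X]ger0_norm ?sqr_ge0//.
  have h1 : `|2 * s ^+ 2 * dotv z phi| <= s * (4 * K) * u.
    rewrite normrM ger0_norm ?mulr_ge0 ?sqr_ge0//.
    apply: (@le_trans _ _ (2 * s ^+ 2 * (Z * Fn))).
      by rewrite ler_wpM2l ?normr_dotv_le// mulr_ge0 ?sqr_ge0.
    have -> : 2 * s ^+ 2 * (Z * Fn) = 2 * s * (Z * (s * Fn)) by ring.
    have -> : s * (4 * K) * u = 2 * s * (K * (2 * u)) by ring.
    rewrite ler_wpM2l//; first by rewrite mulr_ge0// ltW.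
    apply: (@le_trans _ _ ((1 + Z) * (K * (1 + Z)))).
      by apply: ler_pM => //; [rewrite mulr_ge0// ltW|rewrite lerDr].
    by rewrite mulrCA -expr2 ler_wpM2l.
  have h2 : (s ^+ 2 * Fn) ^+ 2 <= s * (2 * K ^+ 2) * u.
    have -> : (s ^+ 2 * Fn) ^+ 2 = s ^+ 2 * (s * Fn) ^+ 2 by ring.
    have -> : s * (2 * K ^+ 2) * u = s * (K ^+ 2 * (2 * u)) by ring.
    apply: ler_pM; rewrite ?sqr_ge0//.
    by rewrite expr2 ler_piMl.
  by rewrite /c0; move: h1 h2; lra.
have halc : `|al| <= c0 by apply: (le_trans hal); rewrite ler_piMl.
have al0 : 0 < 1 + al.
  rewrite -(pmulr_rgt0 _ u0) ual; have := sqr_ge0 (hsnorm y); lra.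
have up0 : 0 <= u `^ p by exact: powR_ge0.
pose Q (v : boxT R m) := hsnorm (G *m v) ^+ 2.
pose X (v : boxT R m) := hsnorm (v : 'cV[R]_m) ^+ 2 / s ^+ 2.
pose Mv (v : boxT R m) := (1 + 2 * K * X v) ^+ n.+2.
pose a := u `^ p * (1 + p * al).
pose b := u `^ p * p * kappa / u.
pose c := u `^ p * C1 * s ^+ 2 * (c0 ^+ 2 + 1).
have X0 v : 0 <= X v by rewrite divr_ge0 ?sqr_ge0.
have s20 : 0 < s ^+ 2 by rewrite exprn_gt0.
have mcoord i : measurable_fun setT (fun v : boxT R m => (v : 'cV[R]_m) i 0).
  exact: measurable_coord.
have mGv i : measurable_fun setT (fun v : boxT R m => (G *m v) i 0) by exact: measurable_mulmx.
apply: le_trans (_ : ((a + b * (s ^+ 2 * hsnorm G ^+ 2) + c * M)%:E <= _)%E).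
  apply: (@integral_sym_le _ _ nu s s0 nuE _ Q Mv) => //.
  - apply: (measurableT_comp (measurable_powR p)); apply: measurable_funD => //.
    apply: measurable_hsnorm_sqr => i.
    rewrite (_ : (fun w => _) = (fun v : boxT R m => y i 0 + (G *m v) i 0)).
      exact: measurable_funD.
    by apply/funext => v; rewrite mxE.
  - exact: measurable_hsnorm_sqr.
  - apply: measurable_funX; apply: measurable_funD => //; apply: measurable_funM => //.
    by apply: measurable_funM => //; exact: measurable_hsnorm_sqr.
  - by move=> v; exact: powR_ge0.
  - by move=> v; exact: sqr_ge0.
  - by move=> v; rewrite exprn_ge0// addr_ge0// mulr_ge0// mulr_ge0.
  - by rewrite /b !mulr_ge0 ?invr_ge0//; lra.
  - by rewrite /c !mulr_ge0 ?sqr_ge0// addr_ge0// sqr_ge0.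
  - exact: integral_mulmx_sq_le.
  - by apply: integral_moment_le => //; rewrite mulr_ge0.
  move=> v; rewrite -/y mulmxN.
  set gv := G *m v.
  pose be := Q v / u; pose ga := 2 * dotv y gv / u.
  have Q0 : 0 <= Q v by exact: sqr_ge0.
  have be0 : 0 <= be by rewrite divr_ge0// ltW.
  have ube : u * be = Q v by rewrite /be mulrCA divff ?gt_eqF// mulr1.
  have uga : u * ga = 2 * dotv y gv by rewrite /ga mulrCA divff ?gt_eqF// mulr1.
  have hga : ga ^+ 2 <= 4 * (1 + al) * be.
    rewrite -(ler_pM2l (exprn_gt0 2 u0)) -exprMn uga.
    have -> : u ^+ 2 * (4 * (1 + al) * be) = 4 * ((u * (1 + al)) * (u * be)) by ring.
    rewrite ual ube exprMn; have := dotv_sqr_le y gv.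
    by rewrite -/(Q v) mulrDl mul1r; lra.
  have E1 : 1 + hsnorm (y + gv) ^+ 2 = u * (1 + al + be + ga).
    by rewrite hsnormD_sqr -/(Q v) mulrDr uga mulrDr ube ual; ring.
  have E2 : 1 + hsnorm (y - gv) ^+ 2 = u * (1 + al + be - ga).
    by rewrite hsnormD_sqr hsnormN dotvNr -/(Q v) mulrBr uga mulrDr ube ual; ring.
  have P1 : 0 <= 1 + al + be + ga.
    rewrite -(pmulr_rge0 _ u0) -E1; have := sqr_ge0 (hsnorm (y + gv)); lra.
  have P2 : 0 <= 1 + al + be - ga.
    rewrite -(pmulr_rge0 _ u0) -E2; have := sqr_ge0 (hsnorm (y - gv)); lra.
  rewrite E1 E2 !powRM ?(ltW u0)// -mulrDr.
  apply: (le_trans (ler_wpM2l up0 (hC1 al be ga halc al0 be0 hga))).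
  have hbe : be <= s * (2 * K * X v).
    rewrite -(ler_pM2l u0) ube; apply: (le_trans (hsnorm_mulmx_le G v)).
    have -> : u * (s * (2 * K * X v)) = K * (2 * u) * (s * X v) by ring.
    have -> : hsnorm G ^+ 2 * hsnorm v ^+ 2 = (s * hsnorm G ^+ 2) * (s * X v).
      by rewrite /X; field; rewrite gt_eqF.
    apply: ler_wpM2r; first by rewrite mulr_ge0.
    by apply: (le_trans hG); rewrite ler_wpM2l.
  set kx := 2 * K * X v in hbe.
  have kx0 : 0 <= kx by exact: mulr_ge0 (mulr_ge0 (ler0n _ _) K0) (X0 v).
  have hbe1 : be <= kx by apply: (le_trans hbe); rewrite ler_piMl.
  (* The error has expectation of order s ^+ 2: |al| <= s * c0 and
     be <= s * kx, where kx is a function of the standardized increment. *)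
  have hfin : C1 * (al ^+ 2 + be ^+ 2) * (1 + be) ^+ n <=
      C1 * s ^+ 2 * (c0 ^+ 2 + 1) * Mv v.
    rewrite /Mv -/kx.
    have g1 : al ^+ 2 + be ^+ 2 <= s ^+ 2 * (c0 ^+ 2 + 1) * (1 + kx) ^+ 2.
      exact: sqr_add_le.
    have g2 : (1 + be) ^+ n <= (1 + kx) ^+ n.
      by rewrite lerXn2r ?nnegrE ?addr_ge0// lerD2l.
    have -> : C1 * s ^+ 2 * (c0 ^+ 2 + 1) * (1 + kx) ^+ n.+2 =
      C1 * (s ^+ 2 * (c0 ^+ 2 + 1) * (1 + kx) ^+ 2) * (1 + kx) ^+ n.
      by rewrite (_ : (1 + kx) ^+ n.+2 = (1 + kx) ^+ 2 * (1 + kx) ^+ n); [ring|rewrite -exprD].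
    have A0 : 0 <= al ^+ 2 + be ^+ 2 by rewrite addr_ge0 ?sqr_ge0.
    apply: ler_pM => //.
    - exact: mulr_ge0.
    - by rewrite exprn_ge0// addr_ge0.
    - by rewrite ler_wpM2l.
  have -> : 2 * (a + b * Q v + c * Mv v) =
     u `^ p * (2 * (1 + p * al + p * kappa * be + C1 * s ^+ 2 * (c0 ^+ 2 + 1) * Mv v)).
    by rewrite /a /b /c /be; field; rewrite gt_eqF.
  by rewrite ler_wpM2l// ler_wpM2l// lerD2l.
have upE : u `^ p = u * u `^ (p - 1) by rewrite mulr_powRB1// ltW.
rewrite lee_fin dotvZl.
have -> : a + b * (s ^+ 2 * hsnorm G ^+ 2) + c * M =
   u `^ p + s ^+ 2 * p * (u `^ (p - 1) * (2 * dotv z phi + kappa * hsnorm G ^+ 2))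
   + (s ^+ 2 * p * ((s * Fn) ^+ 2 * u `^ (p - 1)) + C1 * (c0 ^+ 2 + 1) * M * s ^+ 2 * u `^ p).
  rewrite /a /b /c /al upE; field; by rewrite gt_eqF.
rewrite lerD2l.
have -> : (2 * p * K ^+ 2 + C1 * (c0 ^+ 2 + 1) * M) * s ^+ 2 * u `^ p =
  s ^+ 2 * p * (K ^+ 2 * (2 * u) * u `^ (p - 1)) + C1 * (c0 ^+ 2 + 1) * M * s ^+ 2 * u `^ p.
  by rewrite upE; ring.
rewrite lerD2r ler_wpM2l//; first by rewrite mulr_ge0 ?sqr_ge0// ltW.
by rewrite ler_wpM2r// powR_ge0.
Qed.

End OneStep.

(** * Independence and measurability *)

Section Independence.
Local Open Scope ereal_scope.
Context d d1 d2 (Omega : measurableType d) (T1 : measurableType d1)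
  (T2 : measurableType d2) (R : realType).
Variables (P : probability Omega R) (X : {mfun Omega >-> T1}) (Y : {mfun Omega >-> T2}).
Hypothesis XY_indep : forall A B, measurable A -> measurable B ->
  P (X @^-1` A `&` Y @^-1` B) = P (X @^-1` A) * P (Y @^-1` B).

Let XY : Omega -> T1 * T2 := fun w => (X w, Y w).

Let mXY : measurable_fun setT XY.
Proof. by apply: measurable_fun_pair. Qed.

(** Freezing: the law of [(X, Y)] is the product of the two laws, and Tonelli's
    theorem applies. *)
Lemma ge0_integral_indep (H : T1 * T2 -> \bar R) :
  measurable_fun setT H -> (forall x, 0 <= H x) ->
  \int[P]_w H (X w, Y w) = \int[P]_w \int[distribution P Y]_v H (X w, v).
Proof.
move=> mH H0.
transitivity (\int[pushforward P XY]_z H z).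
  by rewrite ge0_integral_pushforward.
transitivity (\int[distribution P X \x distribution P Y]_z H z).
  apply: eq_measure_integral => C mC _; apply/esym.
  apply: (@product_measure_unique _ _ _ _ _ (distribution P X) (distribution P Y)) => //.
rewrite fubini_tonelli1// ge0_integral_pushforward//.
  exact: measurable_fun_fubini_tonelli_F.
move=> x _; exact: integral_ge0.
Qed.

Lemma measurable_integral_indep (H : T1 * T2 -> \bar R) :
  measurable_fun setT H -> (forall x, 0 <= H x) ->
  measurable_fun setT (fun x => \int[distribution P Y]_v H (x, v)).
Proof.
move=> mH H0; apply: (@measurable_fun_fubini_tonelli_F _ _ _ _ _ (distribution P Y) H mH H0).
Qed.

End Independence.

Section ContinuousMeasurable.
Context {R : realType}.

Lemma measurable_fun_countable d (T : measurableType d) (U : countType)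
    (k : T -> U) (psi : U -> R) :
  (forall u, measurable (k @^-1` [set u])) ->
  measurable_fun setT (fun w => psi (k w)).
Proof.
move=> mk _ B mB; rewrite setTI.
rewrite (_ : _ @^-1` _ = \bigcup_(u : U) (if psi u \in B then k @^-1` [set u] else set0)).
  apply: countable_bigcupT_measurable; first exact: countableP.
  by move=> u; case: ifP.
apply/seteqP; split => [w Bw|w [u _]].
  by exists (k w) => //; rewrite mem_set.
by case: ifPn => // /set_mem Bu /= ->.
Qed.

(** Rounding to multiples of [1 / n.+1] takes countably many values, which makes
    the measurability of any function of a rounded variable immediate. *)
Definition round n (x : R) : R := (Num.floor (n.+1%:R * x))%:~R / n.+1%:R.

Lemma round_dist n x : `|round n x - x| <= n.+1%:R^-1.
Proof.
have n0 : 0 < n.+1%:R :> R by rewrite ltr0n.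
have /andP[h1 h2] := floor_itv (n.+1%:R * x).
have e : x = n.+1%:R * x / n.+1%:R by rewrite mulrC mulKf// gt_eqF.
rewrite /round {2}e -mulrBl normrM [X in _ * X]ger0_norm ?invr_ge0 ?(ltW n0)//.
rewrite ler_piMl ?invr_ge0 ?(ltW n0)// ler0_norm ?subr_le0// opprB.
by rewrite intrD in h2; lra.
Qed.

(** [phi (X w) (Y w)] is the limit of [phi] evaluated at the rounded variables.
    Continuity is only asked for along sequences that converge at the rate of the
    rounding. *)
Lemma measurable_fun_cont2 d (T : measurableType d) a b
    (X : T -> 'cV[R]_a) (Y : T -> 'cV[R]_b) (phi : 'cV[R]_a -> 'cV[R]_b -> R) :
  (forall i, measurable_fun setT (fun w => X w i 0)) ->
  (forall i, measurable_fun setT (fun w => Y w i 0)) ->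
  (forall (x : 'cV[R]_a) (y : 'cV[R]_b) (x_ : nat -> 'cV[R]_a) (y_ : nat -> 'cV[R]_b),
    (forall n i, `|x_ n i 0 - x i 0| <= n.+1%:R^-1) ->
    (forall n i, `|y_ n i 0 - y i 0| <= n.+1%:R^-1) ->
    phi (x_ n) (y_ n) @[n --> \oo] --> phi x y) ->
  measurable_fun setT (fun w => phi (X w) (Y w)).
Proof.
move=> mX mY hphi.
pose rd n c (x : 'cV[R]_c) : 'cV[R]_c := \col_i round n (x i 0).
apply: (@measurable_fun_cvg _ T R setT
   (fun n w => phi (rd n a (X w)) (rd n b (Y w)))); last first.
  by move=> w _; apply: hphi => n i; rewrite mxE round_dist.
move=> n.
pose fl c (x : 'cV[R]_c) : {ffun 'I_c -> int} := [ffun i => Num.floor (n.+1%:R * x i 0)].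
pose un c (k : {ffun 'I_c -> int}) : 'cV[R]_c := \col_i ((k i)%:~R / n.+1%:R).
have rdE c (x : 'cV[R]_c) : rd n c x = un c (fl c x).
  by apply/matrixP => i j; rewrite !mxE ffunE.
have mfl c (Z : T -> 'cV[R]_c) : (forall i, measurable_fun setT (fun w => Z w i 0)) ->
    forall k, measurable [set w | fl c (Z w) = k].
  move=> mZ k.
  rewrite (_ : [set w | _] = \bigcap_(i in [set: 'I_c])
     ((fun w => n.+1%:R * Z w i 0) @^-1` `[(k i)%:~R, (k i + 1)%:~R[)).
    apply: fin_bigcap_measurable => // i _; rewrite -[X in measurable X]setTI.
    by apply: (measurable_funM (measurable_cst _) (mZ i)) => //; exact: measurable_itv.
  apply/seteqP; split => [w /= <- i _|w h].
    by rewrite /= in_itv/= ffunE floor_itv.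
  apply/ffunP => i; rewrite ffunE; apply: floor_def.
  by have := h i I; rewrite /= in_itv.
rewrite (_ : (fun w => _) = (fun w => phi (un a (fl a (X w))) (un b (fl b (Y w))))); last first.
  by apply/funext => w; rewrite !rdE.
apply: (@measurable_fun_countable _ T ({ffun 'I_a -> int} * {ffun 'I_b -> int})%type
  (fun w => (fl a (X w), fl b (Y w))) (fun k => phi (un a k.1) (un b k.2))) => -[k l].
rewrite (_ : _ @^-1` _ = [set w | fl a (X w) = k] `&` [set w | fl b (Y w) = l]).
  by apply: measurableI; exact: mfl.
by apply/seteqP; split => [w /= [-> ->]|w /= [-> ->]].
Qed.

End ContinuousMeasurable.

(** * Consequences of the hypotheses on the coefficients *)

Section Coefs.
Context {R : realType} {d m : nat}.

Lemma hsnorm_le_entries a (x : 'cV[R]_a) e : 0 <= e ->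
  (forall i, `|x i 0| <= e) -> hsnorm x <= a%:R * e.
Proof.
move=> e0 h; rewrite -ler_sqr ?nnegrE ?hsnorm_ge0 ?mulr_ge0//.
rewrite hsnorm_cV_sqr; apply: (@le_trans _ _ (\sum_(i < a) e ^+ 2)).
  apply: ler_sum => i _; rewrite -real_normK ?num_real//.
  by rewrite lerXn2r ?nnegrE.
rewrite sumr_const card_ord -[leLHS]mulr_natl exprMn ler_wpM2r ?sqr_ge0//.
by rewrite -natrX ler_nat; case: a {x h} => // a; rewrite leq_pmulr.
Qed.

Lemma cV_cvg_rate a (x : 'cV[R]_a) (x_ : nat -> 'cV[R]_a) :
  (forall n i, `|x_ n i 0 - x i 0| <= n.+1%:R^-1) -> x_ n @[n --> \oo] --> x.
Proof.
move=> h; apply/cvg_ballP => e e0; near=> n.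
split=> // i j; rewrite (ord1 j) /ball/=.
rewrite distrC; apply: (le_lt_trans (h n i)).
near: n; exact: (near_infty_natSinv_lt (PosNum e0)).
Unshelve. all: by end_near.
Qed.

Variables (f : 'cV[R]_d -> 'cV[R]_d -> 'cV[R]_d)
          (g : 'cV[R]_d -> 'cV[R]_d -> 'M[R]_(d, m)).

(** Joint continuity of the coefficients: move the first argument by the local
    Lipschitz condition, then the second one with the first one fixed. *)
Lemma coef_cvg (x y : 'cV[R]_d) (x_ y_ : nat -> 'cV[R]_d) :
  local_lipschitz1 f g -> locally_uniformly_continuous2 f g ->
  (forall n i, `|x_ n i 0 - x i 0| <= n.+1%:R^-1) ->
  (forall n i, `|y_ n i 0 - y i 0| <= n.+1%:R^-1) ->
  (forall i, f (x_ n) (y_ n) i 0 @[n --> \oo] --> f x y i 0) /\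
  (forall i j, g (x_ n) (y_ n) i j @[n --> \oo] --> g x y i j).
Proof.
move=> H1 H3 hx hy.
have bnd (z : 'cV[R]_d) (z_ : nat -> 'cV[R]_d) n : (forall i, `|z_ n i 0 - z i 0| <= n.+1%:R^-1) ->
    hsnorm (z_ n) <= d%:R * (hsnorm z + 1).
  move=> hz; apply: hsnorm_le_entries => [|i]; first by rewrite addr_ge0 ?hsnorm_ge0.
  have e : z_ n i 0 = z i 0 + (z_ n i 0 - z i 0) by rewrite addrC subrK.
  rewrite e; apply: (le_trans (ler_normD _ _)).
  rewrite lerD ?entry_le_hsnorm//; apply: (le_trans (hz i)).
  by rewrite invf_le1 ?ltr0n// ler1n.
have Hx0 := hsnorm_ge0 x; have Hy0 := hsnorm_ge0 y.
pose l := d%:R * (hsnorm x + 1) + d%:R * (hsnorm y + 1) + hsnorm x + 1.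
have d1 : 0 <= d%:R * (hsnorm x + 1) by rewrite mulr_ge0 ?addr_ge0.
have d2 : 0 <= d%:R * (hsnorm y + 1) by rewrite mulr_ge0 ?addr_ge0.
have l0 : 0 < l by rewrite /l; lra.
have [L L0 hL] := H1 l l0.
have hH3 := H3 (hsnorm x + 1) y ltac:(lra).
pose S y' := ereal_sup [set (hsnorm (f z y' - f z y) + hsnorm (g z y' - g z y))%:E
  | z in [set z | hsnorm z <= hsnorm x + 1]].
have key e : 0 < e -> \forall n \near \oo,
   hsnorm (f (x_ n) (y_ n) - f x (y_ n)) + hsnorm (f x (y_ n) - f x y) <= e /\
   hsnorm (g (x_ n) (y_ n) - g x (y_ n)) + hsnorm (g x (y_ n) - g x y) <= e.
  move=> e0.
  have e20 : 0 < e / 2 by rewrite divr_gt0.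
  have Ld0 : 0 < L * (d%:R + 1) by rewrite mulr_gt0// ltr_wpDl.
  have e3 : 0 < e / 2 / (L * (d%:R + 1)) by rewrite divr_gt0.
  have nb0 : nbhs (0%:E : \bar R) [set z | (z < (e / 2)%:E)%E].
    have : \forall r \near (0 : R), r < e / 2 by exact: (cvgr_lt 0 cvg_id).
    by apply: filterS => r re; rewrite /= lte_fin.
  have near3 : \forall n \near \oo, (S (y_ n) < (e / 2)%:E)%E :=
    cV_cvg_rate hy (hH3 _ nb0).
  near=> n.
  have hn : (n.+1%:R : R)^-1 < e / 2 / (L * (d%:R + 1)).
    by near: n; exact: (near_infty_natSinv_lt (PosNum e3)).
  have hs : hsnorm (f x (y_ n) - f x y) + hsnorm (g x (y_ n) - g x y) < e / 2.
    have hS : (S (y_ n) < (e / 2)%:E)%E by near: n.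
    rewrite -lte_fin; apply: le_lt_trans hS.
    by apply: ereal_sup_ubound; exists x => //=; rewrite lerDl.
  have hl : Num.max (Num.max (hsnorm (x_ n)) (hsnorm x)) (hsnorm (y_ n)) <= l.
    have bx := bnd x x_ n (hx n); have by_ := bnd y y_ n (hy n).
    by rewrite !ge_max; apply/andP; split; [apply/andP; split|]; rewrite /l; lra.
  have hL2 : L * hsnorm (x_ n - x) <= e / 2.
    have h1 : hsnorm (x_ n - x) <= d%:R * n.+1%:R^-1.
      by apply: hsnorm_le_entries => [|i]; rewrite ?invr_ge0// !mxE.
    apply: (@le_trans _ _ (L * ((d%:R + 1) * n.+1%:R^-1))).
      rewrite ler_wpM2l ?(ltW L0)//; apply: (le_trans h1).
      by rewrite ler_wpM2r ?invr_ge0// lerDl.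
    by rewrite mulrA mulrC -ler_pdivlMr// ltW.
  have := hL _ _ _ hl; rewrite ge_max => /andP[hf hg].
  have F0 := hsnorm_ge0 (f x (y_ n) - f x y).
  have G0 := hsnorm_ge0 (g x (y_ n) - g x y).
  by split; lra.
have entry_dist a b (A B C : 'M[R]_(a, b)) i j :
    `|C i j - A i j| <= hsnorm (A - B) + hsnorm (B - C).
  have -> : C i j - A i j = - ((A - B) i j) - (B - C) i j by rewrite !mxE; ring.
  apply: (le_trans (ler_normB _ _)); rewrite normrN.
  by apply: lerD; exact: entry_le_hsnorm.
split=> [i|i j]; apply/cvgrPdist_le => e /key; apply: filterS => n [h1 h2].
  exact: le_trans (entry_dist _ _ _ (f x (y_ n)) _ _ _) h1.
exact: le_trans (entry_dist _ _ _ (g x (y_ n)) _ _ _) h2.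
Unshelve. all: by end_near.
Qed.

Lemma growth_coef Phi Phiinv l x y : truncation_function f g Phi Phiinv ->
  1 <= l -> hsnorm x <= l -> hsnorm y <= l ->
  hsnorm (f x y) <= Phi l * (1 + hsnorm x) /\
  hsnorm (g x y) ^+ 2 <= Phi l * (1 + hsnorm x) ^+ 2.
Proof.
move=> [_ hP] l1 xl yl.
have x1 : 0 < 1 + hsnorm x by rewrite ltr_pwDl// hsnorm_ge0.
have : ((Num.max (hsnorm (f x y) / (1 + hsnorm x))
          (hsnorm (g x y) ^+ 2 / (1 + hsnorm x) ^+ 2))%:E <= (Phi l)%:E)%E.
  apply: le_trans (hP l l1); apply: ereal_sup_ubound; exists (x, y) => //=.
  by rewrite ge_max xl yl.
rewrite lee_fin ge_max => /andP[hf hg]; split; first by rewrite -ler_pdivrMr.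
by rewrite -ler_pdivrMr ?exprn_gt0.
Qed.

End Coefs.

Section Truncation.
Context {R : realType} {d m : nat}.
Variables (f : 'cV[R]_d -> 'cV[R]_d -> 'cV[R]_d)
          (g : 'cV[R]_d -> 'cV[R]_d -> 'M[R]_(d, m)).
Variables (tau : R) (xi : R -> 'cV[R]_d) (Phi Phiinv : R -> R) (mu : R).
Hypothesis tau0 : 0 < tau.
Hypothesis hxi : {within `[- tau, 0], continuous xi}.
Hypothesis hP : truncation_function f g Phi Phiinv.
Hypothesis mu0 : 0 < mu.

Lemma hsnorm_continuous : continuous (fun x : 'cV[R]_d => hsnorm x).
Proof.
have hc : continuous (fun x : 'cV[R]_d => \sum_i \sum_j x i j ^+ 2).
  apply: continuous_big => [|i _]; first exact: add_continuous.
  apply: continuous_big => [|j _]; first exact: add_continuous.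
  move=> y; apply: (continuous_comp (f := fun x : 'cV[R]_d => x i j) (g := fun r : R => r ^+ 2)).
    exact: coord_continuous.
  exact: sqr_continuous.
move=> x; apply: (continuous_comp (f := fun x : 'cV[R]_d => \sum_i \sum_j x i j ^+ 2)
  (g := Num.sqrt)); [exact: hc|exact: sqrt_continuous].
Qed.

Lemma xi_le_supnorm t : - tau <= t <= 0 -> hsnorm (xi t) <= supnorm tau xi.
Proof.
move=> ht.
have hc : {within `[- tau, 0], continuous (fun t => hsnorm (xi t))}.
  move=> s; apply: cvg_comp; [exact: hxi|exact: hsnorm_continuous].
have tau00 : - tau <= 0 by lra.
have [c _ hc2] := EVT_max tau00 hc.
apply: ub_le_sup; last by exists t => //=; rewrite in_itv.
by exists (hsnorm (xi c)) => _ [s hs <-]; apply: hc2.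
Qed.

Let L0 := Num.max (supnorm tau xi) 1.

(** The level exists by the intermediate value theorem, since [hPhi D] is at least
    [Phi L0] when [D <= 1]; as a left inverse, [Phiinv] returns it. *)
Lemma truncation_level D : 0 < D -> D <= 1 ->
  exists2 rho, L0 <= rho & Phi rho = hPhi tau xi Phi mu D /\
    Phiinv (hPhi tau xi Phi mu D) = rho.
Proof.
move=> D0 D1; have [[P0 Pincr Pcont Poo Pinv] _] := hP.
have L01 : 1 <= L0 by rewrite le_max lexx orbT.
set h := hPhi tau xi Phi mu D.
have hK : Phi L0 <= h.
  rewrite /h /hPhi -/L0 ler_peMr ?P0//.
  rewrite -[leLHS](powRr0 D) ger_powR ?D0//.
  by rewrite oppr_le0 ltW.
have [b [bL0 bh]] : exists b, L0 <= b /\ h <= Phi b.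
  have hoo := (cvgryPge _).1 Poo h.
  have [M [_ hM]] := hoo.
  exists (Num.max L0 (M + 1)); split; first by rewrite le_max lexx.
  by apply: hM; rewrite lt_max ltrDl ltr01 orbT.
have cont : {within `[L0, b], continuous Phi}.
  apply: continuous_subspaceW Pcont => t /=; rewrite !in_itv/= => /andP[t1 _].
  by rewrite andbT (le_trans L01).
have [|rho] := IVT bL0 cont (v := h).
  by rewrite ge_min hK/= le_max bh orbT.
rewrite in_itv/= => /andP[r1 _] e; exists rho => //; split=> //.
by rewrite -e Pinv// in_itv/= andbT (le_trans L01).
Qed.

Lemma truncation_le D x : 0 < D -> D <= 1 ->
  hsnorm (truncation tau xi Phi Phiinv mu D x) <= hsnorm x /\
  hsnorm (truncation tau xi Phi Phiinv mu D x) <= Phiinv (hPhi tau xi Phi mu D).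
Proof.
move=> D0 D1; have [rho r0 [_ e]] := truncation_level D0 D1.
rewrite /truncation e.
have rho0 : 0 <= rho by apply: le_trans r0; rewrite le_max ler01 orbT.
have min0 : 0 <= Num.min (hsnorm x) rho by rewrite le_min hsnorm_ge0 rho0.
have h : hsnorm (Num.min (hsnorm x) rho *: ((hsnorm x)^-1 *: x)) <= Num.min (hsnorm x) rho.
  rewrite hsnormZ ger0_norm// ler_piMr// hsnormZ ger0_norm ?invr_ge0 ?hsnorm_ge0//.
  have [->|x0] := eqVneq (hsnorm x) 0; first by rewrite mulr0.
  by rewrite mulVf.
by split; apply: (le_trans h); rewrite ge_min lexx ?orbT.
Qed.

End Truncation.

Section VBound.
Context {R : realType} {d m : nat}.
Variables (f : 'cV[R]_d -> 'cV[R]_d -> 'cV[R]_d)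
          (g : 'cV[R]_d -> 'cV[R]_d -> 'M[R]_(d, m)).

Lemma hsnorm_powR_le (q : R) (x : 'cV[R]_d) : 0 <= q ->
  hsnorm x `^ q <= (1 + hsnorm x ^+ 2) `^ (q / 2).
Proof.
move=> q0.
have -> : hsnorm x `^ q = (hsnorm x ^+ 2) `^ (q / 2).
  by rewrite -powR_mulrn ?hsnorm_ge0// -powRrM; congr (_ `^ _); field.
by rewrite ge0_ler_powR ?nnegrE ?divr_ge0 ?addr_ge0 ?sqr_ge0// lerDr.
Qed.

(** The Khasminskii condition at [y = 0] bounds [K2 * V1 x] in terms of [f x 0],
    whose growth on balls is controlled by [Phi]. *)
Lemma lyapunov_bounded (q K1 K2 : R) (V1 : 'cV[R]_d -> R) Phi Phiinv l :
  0 < q -> 0 <= K1 -> truncation_function f g Phi Phiinv -> 1 <= l ->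
  (forall x y : 'cV[R]_d,
        (1 + hsnorm x ^+ 2) `^ (q / 2 - 1) *
          (dotv (2 *: x) (f x y) + Num.max (q - 1) 1 * hsnorm (g x y) ^+ 2)
        <= K1 * (1 + hsnorm x `^ q + hsnorm y `^ q) - K2 * (V1 x - V1 y)) ->
  exists B, forall x, hsnorm x <= l -> K2 * V1 x <= B.
Proof.
move=> q0 K10 hP l1 H2.
exists (K1 * (1 + (1 + l ^+ 2) `^ (q / 2)) + 4 * Phi l * (1 + l ^+ 2) `^ (q / 2) + K2 * V1 0).
move=> x xl.
have hn0 : hsnorm (0 : 'cV[R]_d) = 0.
  by rewrite -(scale0r (0 : 'cV[R]_d)) hsnormZ normr0 mul0r.
have := H2 x 0; rewrite hn0 powR0 ?gt_eqF// addr0.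
have [hf _] := growth_coef (y := 0) hP l1 xl ltac:(by rewrite hn0; lra).
set u := 1 + hsnorm x ^+ 2; set w := u `^ (q / 2 - 1).
have x0 := hsnorm_ge0 x.
have u0 : 0 < u by rewrite ltr_pwDl// sqr_ge0.
have w0 : 0 <= w by exact: powR_ge0.
have uw : u * w = u `^ (q / 2) by rewrite mulr_powRB1 ?divr_gt0// ltW.
have uL : u `^ (q / 2) <= (1 + l ^+ 2) `^ (q / 2).
  rewrite ge0_ler_powR ?nnegrE ?divr_ge0 ?addr_ge0 ?sqr_ge0 ?(ltW q0)//.
  by rewrite lerD2l lerXn2r ?nnegrE//; lra.
have xq := hsnorm_powR_le x (ltW q0).
have Phi0 : 0 <= Phi l by have [[P0 _ _ _ _] _] := hP; exact: P0.
have k0 : 0 <= Num.max (q - 1) 1 * hsnorm (g x 0) ^+ 2.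
  by rewrite mulr_ge0 ?sqr_ge0// le_max ler01 orbT.
have hd : - (4 * Phi l * u) <= dotv (2 *: x) (f x 0).
  rewrite dotvZl; have := normr_dotv_le x (f x 0); rewrite ler_norml => /andP[h1 _].
  have : hsnorm x * hsnorm (f x 0) <= (1 + hsnorm x) * (Phi l * (1 + hsnorm x)).
    by apply: ler_pM; rewrite ?hsnorm_ge0// lerDr.
  have : Phi l * (1 + hsnorm x) ^+ 2 <= Phi l * (2 * u).
    by rewrite ler_wpM2l// /u; have := sqr_ge0 (1 - hsnorm x); nra.
  by rewrite expr2; lra.
have h3 : w * - (4 * Phi l * u) <=
    w * (dotv (2 *: x) (f x 0) + Num.max (q - 1) 1 * hsnorm (g x 0) ^+ 2).
  by rewrite ler_wpM2l//; lra.
have h4 : K1 * (1 + hsnorm x `^ q) <= K1 * (1 + (1 + l ^+ 2) `^ (q / 2)).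
  by rewrite ler_wpM2l// lerD2l (le_trans xq).
have h5 : Phi l * (u * w) <= Phi l * (1 + l ^+ 2) `^ (q / 2) by rewrite uw ler_wpM2l.
lra.
Qed.

End VBound.

(** * Adaptedness of the scheme *)

Section MeasurableTools.
Context {R : realType} {d' : measure_display} {T : measurableType d'}.

Lemma measurable_fun_hsnorm d (X : T -> 'cV[R]_d) :
  (forall i, measurable_fun setT (fun w => X w i 0)) ->
  measurable_fun setT (fun w => hsnorm (X w)).
Proof.
move=> mX; rewrite (_ : (fun w => _) = (fun w => Num.sqrt (hsnorm (X w) ^+ 2))).
  apply: (measurableT_comp (f := @Num.sqrt R)).
    apply: continuous_measurable_fun; exact: sqrt_continuous.
  exact: measurable_hsnorm_sqr.
by apply/funext => w; rewrite sqrtr_sqr ger0_norm ?hsnorm_ge0.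
Qed.

Lemma measurable_fun_truncation d tau (xi : R -> 'cV[R]_d) Phi Phiinv mu D (X : T -> 'cV[R]_d) i :
  (forall i, measurable_fun setT (fun w => X w i 0)) ->
  measurable_fun setT (fun w => truncation tau xi Phi Phiinv mu D (X w) i 0).
Proof.
move=> mX; set rho := Phiinv (hPhi tau xi Phi mu D).
rewrite (_ : (fun w => _) = (fun w =>
    Num.min (hsnorm (X w)) rho * (hsnorm (X w) `^ (-1) * X w i 0))).
  apply: measurable_funM.
    by apply: measurable_minr => //; exact: measurable_fun_hsnorm.
  apply: measurable_funM => //.
  apply: (measurableT_comp (measurable_powR (-1))); exact: measurable_fun_hsnorm.
by apply/funext => w; rewrite /truncation !mxE powR_inv1 ?hsnorm_ge0.
Qed.

End MeasurableTools.

Section Borel.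
Context {R : realType} {m : nat}.

Lemma borel_coord (i : 'I_m) (B : set R) : measurable B ->
  @borel_cV R m [set v : 'cV[R]_m | B (v i 0)].
Proof.
move=> mB.
pose T := g_sigma_algebraType [set U : set 'cV[R]_m | open U].
suff : measurable_fun (setT : set T) (fun v : T => (v : 'cV[R]_m) i 0).
  by move=> /(_ measurableT B mB); rewrite setTI.
apply: (measurability _ (RGenOInfty.measurableE R)).
move=> _ [_ [x ->] <-]; rewrite setTI; apply: sub_sigma_algebra => /=.
apply: (open_comp (f := fun v : 'cV[R]_m => v i 0)) => //.
  by move=> v _; exact: coord_continuous.
Qed.

(** Needed because the independence of increments is stated for Borel sets. *)
Lemma borel_boxT (B : set (boxT R m)) : measurable B -> @borel_cV R m B.
Proof.
move: B; apply: smallest_sub; first exact: smallest_sigma_algebra.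
move=> _ [B [mB ->]].
pose T := g_sigma_algebraType [set U : set 'cV[R]_m | open U].
suff : measurable [set v : T | forall i, B i ((v : 'cV[R]_m) i 0)] by [].
rewrite (_ : [set v : T | _] = \bigcap_(i in [set: 'I_m]) [set v : T | B i ((v : 'cV[R]_m) i 0)]).
  by apply: fin_bigcap_measurable => // i _; exact: borel_coord.
by apply/seteqP; split => [v h i _|v h i]; [exact: h|exact: (h i)].
Qed.

End Borel.

Section Adapted.
Context {R : realType} {d m : nat} {disp : measure_display} {Omega : measurableType disp}.
Variables (tau : R) (f : 'cV[R]_d -> 'cV[R]_d -> 'cV[R]_d)
  (g : 'cV[R]_d -> 'cV[R]_d -> 'M[R]_(d, m)) (P : probability Omega R)
  (F : R -> set (set Omega)) (W : R -> Omega -> 'cV[R]_m)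
  (xi : R -> 'cV[R]_d) (Phi Phiinv : R -> R) (mu : R).
Hypotheses (htau : 0 < tau) (hF : filtration F) (hW : brownian_motion P F W)
  (H1 : local_lipschitz1 f g) (H3 : locally_uniformly_continuous2 f g).

(** [Omega] with the sigma-algebra of the events known at time [t], so that
    adaptedness becomes measurability. *)
Definition past (t : R) := g_sigma_algebraType (F t).
HB.instance Definition _ t := Measurable.on (past t).

Lemma past_measurableE t : 0 <= t -> (measurable : set (set (past t))) = F t.
Proof. by move=> t0; apply: sigma_algebra_id; have [+ _] := hF => /(_ t t0)[]. Qed.

Lemma past_measurable_mono s t (X : Omega -> R) : 0 <= s -> s <= t ->
  measurable_fun setT (X : past s -> R) -> measurable_fun setT (X : past t -> R).
Proof.
move=> s0 st mX _ B mB; rewrite setTI past_measurableE ?(le_trans s0)//.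
have [_ /(_ s t s0 st)] := hF; apply.
by have := mX measurableT B mB; rewrite setTI past_measurableE.
Qed.

Lemma past_measurable_fun t (X : Omega -> R) : 0 <= t ->
  measurable_fun setT (X : past t -> R) -> measurable_fun setT X.
Proof.
move=> t0 mX _ B mB; rewrite setTI.
have [/(_ t t0)[_ + ] _] := hF; apply.
by have := mX measurableT B mB; rewrite setTI past_measurableE.
Qed.

Lemma past_measurable_brownian t i : 0 <= t ->
  measurable_fun setT ((fun w => W t w i 0) : past t -> R).
Proof.
move=> t0 _ B mB; rewrite setTI past_measurableE//.
exact: (bm_adapted hW t0 (borel_coord i mB)).
Qed.

Lemma measurable_coef d' (T : measurableType d') (X Y : T -> 'cV[R]_d) :
  (forall i, measurable_fun setT (fun w => X w i 0)) ->
  (forall i, measurable_fun setT (fun w => Y w i 0)) ->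
  (forall i, measurable_fun setT (fun w => f (X w) (Y w) i 0)) /\
  (forall i j, measurable_fun setT (fun w => g (X w) (Y w) i j)).
Proof.
move=> mX mY; split=> [i|i j].
  apply: (measurable_fun_cont2 (phi := fun x y => f x y i 0)) => // x y x_ y_ hx hy.
  by have [+ _] := coef_cvg H1 H3 hx hy; apply.
apply: (measurable_fun_cont2 (phi := fun x y => g x y i j)) => // x y x_ y_ hx hy.
by have [_] := coef_cvg H1 H3 hx hy; apply.
Qed.

Variable N : nat.
Hypothesis N0 : (0 < N)%N.
Local Notation D := (stepsize tau N).
Local Notation Z n j w := (tem_segment f g tau xi Phi Phiinv mu N (fun t => W t w) n j).

Lemma stepsize_gt0 : 0 < D.
Proof. by rewrite divr_gt0// ltr0n. Qed.

Lemma past_measurable_tem n j i :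
  measurable_fun setT ((fun w => Z n j w i 0) : past (n%:R * D) -> R).
Proof.
have D0 := stepsize_gt0.
elim: n j i => [|n IH] [|j] i /=; try exact: measurable_cst.
  have tn : n%:R * D <= n.+1%:R * D by rewrite ler_wpM2r ?ler_nat// ltW.
  have n0 : 0 <= n%:R * D by rewrite mulr_ge0// ltW.
  have n1 : 0 <= n.+1%:R * D by rewrite mulr_ge0// ltW.
  have mZ k l : measurable_fun setT ((fun w => Z n k w l 0) : past (n.+1%:R * D) -> R).
    exact: past_measurable_mono n0 tn (IH k l).
  have [mf mg] := measurable_coef (X := (fun w => Z n 0 w) : past (n.+1%:R * D) -> _)
    (Y := (fun w => Z n N w) : past (n.+1%:R * D) -> _) (mZ 0%N) (mZ N).
  apply: measurable_fun_truncation => k.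
  rewrite (_ : (fun w => _) = (fun w : past (n.+1%:R * D) =>
     Z n 0 w k 0 + D * f (Z n 0 w) (Z n N w) k 0 +
     \sum_(l <- index_enum 'I_m) g (Z n 0 w) (Z n N w) k l *
        (W (n.+1%:R * D) w l 0 - W (n%:R * D) w l 0))).
    apply: measurable_funD.
      by apply: measurable_funD => //; exact: measurable_funM.
    apply: measurable_sum => l; apply: measurable_funM => //.
    apply: measurable_funB; first exact: past_measurable_brownian.
    exact: past_measurable_mono n0 tn (past_measurable_brownian l n0).
  apply/funext => w; rewrite !mxE; congr (_ + _).
  by apply: eq_bigr => l _; rewrite !mxE.
have tn : n%:R * D <= n.+1%:R * D by rewrite ler_wpM2r ?ler_nat// ltW.
have n0 : 0 <= n%:R * D by rewrite mulr_ge0// ltW.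
exact: past_measurable_mono n0 tn (IH j i).
Qed.

Lemma measurable_tem n j i : measurable_fun setT (fun w => Z n j w i 0).
Proof.
apply: (past_measurable_fun (t := n%:R * D)); last exact: past_measurable_tem.
by rewrite mulr_ge0// ltW// stepsize_gt0.
Qed.

End Adapted.

(** * One step of the scheme in expectation *)

Section Scheme.
Context {R : realType} {d m : nat} {disp : measure_display} {Omega : measurableType disp}.
Variables (tau : R) (f : 'cV[R]_d -> 'cV[R]_d -> 'cV[R]_d)
  (g : 'cV[R]_d -> 'cV[R]_d -> 'M[R]_(d, m)) (P : probability Omega R)
  (F : R -> set (set Omega)) (W : R -> Omega -> 'cV[R]_m)
  (xi : R -> 'cV[R]_d) (Phi Phiinv : R -> R) (mu : R).
Hypotheses (htau : 0 < tau) (hF : filtration F) (hW : brownian_motion P F W)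
  (hxi : {within `[- tau, 0], continuous xi})
  (hPhiP : truncation_function f g Phi Phiinv)
  (hmu0 : 0 < mu) (hmu : mu <= 1 / 2)
  (H1 : local_lipschitz1 f g) (H3 : locally_uniformly_continuous2 f g).
Variable N : nat.
Hypotheses (N0 : (0 < N)%N) (D1 : stepsize tau N <= 1).
Local Notation D := (stepsize tau N).
Local Notation Z n j w := (tem_segment f g tau xi Phi Phiinv mu N (fun t => W t w) n j).
Let L0 := Num.max (supnorm tau xi) 1.
Let D0 : 0 < D := stepsize_gt0 htau N0.

Lemma xi_node_le j : (j <= N)%N -> hsnorm (xi (- (j%:R * D))) <= L0.
Proof.
move=> jN; rewrite le_max; apply/orP; left.
apply: xi_le_supnorm => //; rewrite oppr_le0 lerN2 mulr_ge0 ?(ltW D0)// andbT.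
have tauE : N%:R * D = tau by rewrite /stepsize mulrCA divff ?mulr1// pnatr_eq0 -lt0n.
by rewrite -[leRHS]tauE ler_wpM2r ?ler_nat// ltW.
Qed.

Lemma tem_le rho n j w : L0 <= rho -> Phiinv (hPhi tau xi Phi mu D) = rho ->
  (j <= N)%N -> hsnorm (Z n j w) <= rho.
Proof.
move=> Lr er; elim: n j => [|n IH] [|j] jN /=.
- exact: le_trans (xi_node_le jN) Lr.
- exact: le_trans (xi_node_le jN) Lr.
- rewrite -er; set x := (X in truncation _ _ _ _ _ _ X).
  by have [] := truncation_le tau xi hPhiP hmu0 x D0 D1.
- by apply: IH; exact: ltnW.
Qed.

(** [sqrt D * Phi rho = K * D `^ (1/2 - mu) <= K]; this is where [mu <= 1/2] is
    used. *)
Lemma scaled_growth n w : let z := Z n 0 w in let zd := Z n N w in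
  Num.sqrt D * hsnorm (f z zd) <= Phi L0 * (1 + hsnorm z) /\
  Num.sqrt D * hsnorm (g z zd) ^+ 2 <= Phi L0 * (1 + hsnorm z) ^+ 2.
Proof.
move=> z zd.
have [rho Lr [Pr er]] := truncation_level tau xi hPhiP hmu0 D0 D1.
have L01 : 1 <= L0 by rewrite le_max lexx orbT.
have [hf hg] := growth_coef hPhiP (le_trans L01 Lr) (tem_le n w Lr er (leq0n _))
  (tem_le n w Lr er (leqnn _)).
have K0 : 0 <= Phi L0 by have [[P0 _ _ _ _] _] := hPhiP; exact: P0.
have sK : Num.sqrt D * Phi rho <= Phi L0.
  rewrite Pr /hPhi -/L0 mulrCA ler_piMr// -powR12_sqrt ?(ltW D0)//.
  rewrite -powRD; last by rewrite (gt_eqF D0) implybT.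
  rewrite -[leRHS](powRr0 D); apply: ger_powR; first by rewrite D0.
  move: hmu; lra.
have z0 : 0 <= 1 + hsnorm z by rewrite addr_ge0// hsnorm_ge0.
have s0 : 0 <= Num.sqrt D by exact: sqrtr_ge0.
split.
  apply: (le_trans (ler_wpM2l s0 hf)).
  by rewrite mulrA ler_wpM2r.
apply: (le_trans (ler_wpM2l s0 hg)).
by rewrite mulrA ler_wpM2r// sqr_ge0.
Qed.

Section EnergyStep.
Variables (p C : R).
Hypothesis p0 : 0 < p.
Hypothesis hC : one_step_bound m p (Phi L0) C.

(** Dropping the truncation, the next state is a function of the past and of the
    independent increment; integrating the latter first leaves [hC] for the frozen
    state. *)
Lemma conditional_step n (rhs : Omega -> \bar R) :
  measurable_fun setT rhs ->
  (forall w, ((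
     (1 + hsnorm (Z n 0 w) ^+ 2) `^ p + D * p * ((1 + hsnorm (Z n 0 w) ^+ 2) `^ (p - 1) *
     (dotv (2 *: Z n 0 w) (f (Z n 0 w) (Z n N w)) +
       Num.max (2 * p - 1) 1 * hsnorm (g (Z n 0 w) (Z n N w)) ^+ 2))
    + C * D * (1 + hsnorm (Z n 0 w) ^+ 2) `^ p)%:E <= rhs w)%E) ->
  (\int[P]_w ((1 + hsnorm (Z n.+1 0 w) ^+ 2) `^ p)%:E <= \int[P]_w rhs w)%E.
Proof.
move=> mrhs hrhs.
pose t := n%:R * D; pose t' := n.+1%:R * D.
have t0 : 0 <= t by rewrite mulr_ge0// ltW.
have tt' : t < t' by rewrite ltr_pM2r// ltr_nat.
have tD : t' - t = D by rewrite /t' /t -mulrBl -natrB// subSnn mul1r.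
have mid : measurable_fun setT (idfun : Omega -> past F t).
  move=> _ A; rewrite setTI (past_measurableE hF)// => FA.
  by have [/(_ t t0)[_ +] _] := hF; apply.
pose X : {mfun Omega >-> past F t} := HB.pack (idfun : Omega -> past F t)
  (isMeasurableFun.Build _ _ _ _ _ mid).
have t'0 : 0 <= t' by rewrite mulr_ge0// ltW.
have mW s i : 0 <= s -> measurable_fun setT (fun w => W s w i 0).
  move=> s0; apply: (past_measurable_fun hF s0); exact: (past_measurable_brownian hF hW).
have mdW : measurable_fun setT ((fun w => W t' w - W t w) : Omega -> boxT R m).
  apply: measurable_fun_boxT => i.
  rewrite (_ : (fun w => _) = (fun w => W t' w i 0 - W t w i 0)).
    by apply: measurable_funB; exact: mW.
  by apply/funext => w; rewrite !mxE.
pose Y : {mfun Omega >-> boxT R m} := HB.pack ((fun w => W t' w - W t w) : Omega -> boxT R m)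
  (isMeasurableFun.Build _ _ _ _ _ mdW).
have XY A B : measurable A -> measurable B ->
  P (X @^-1` A `&` Y @^-1` B) = (P (X @^-1` A) * P (Y @^-1` B))%E.
  move=> mA mB; rewrite (past_measurableE hF) // in mA.
  exact: (bm_independent hW t0 tt' mA (borel_boxT mB)).
have nuE : iid_normal (distribution P Y) (Num.sqrt D).
  by move=> B mB; have := bm_gaussian hW t0 tt' mB; rewrite tD.
pose y (wv : past F t * boxT R m) : 'cV[R]_d :=
  Z n 0 wv.1 + D *: f (Z n 0 wv.1) (Z n N wv.1) + g (Z n 0 wv.1) (Z n N wv.1) *m wv.2.
pose H wv := ((1 + hsnorm (y wv) ^+ 2) `^ p)%:E.
have H0 wv : (0 <= H wv)%E by rewrite lee_fin powR_ge0.
have mZ j i : measurable_fun setT ((fun w => Z n j w i 0) : past F t -> R).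
  exact: (past_measurable_tem xi Phi Phiinv mu htau hF hW H1 H3 N0).
have [mf mg] := measurable_coef H1 H3 (X := (fun w => Z n 0 w) : past F t -> _)
    (Y := (fun w => Z n N w) : past F t -> _) (mZ 0%N) (mZ N).
have mH : measurable_fun setT H.
  apply/measurable_EFinP; apply: (measurableT_comp (measurable_powR p)).
  apply: measurable_funD => //; apply: measurable_hsnorm_sqr => i.
  rewrite (_ : (fun w => _) = (fun wv : past F t * boxT R m =>
     Z n 0 wv.1 i 0 + D * f (Z n 0 wv.1) (Z n N wv.1) i 0 +
     \sum_(l <- index_enum 'I_m) g (Z n 0 wv.1) (Z n N wv.1) i l * (wv.2 : 'cV[R]_m) l 0)).
    apply: measurable_funD.
      apply: measurable_funD; first exact: (measurableT_comp (mZ 0%N i) measurable_fst).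
      apply: measurable_funM => //; exact: (measurableT_comp (mf i) measurable_fst).
    apply: measurable_sum => l; apply: measurable_funM.
      exact: (measurableT_comp (mg i l) measurable_fst).
    exact: (measurableT_comp (measurable_coord l) measurable_snd).
  by apply/funext => wv; rewrite !mxE.
apply: (@le_trans _ _ (\int[P]_w H (X w, Y w))%E).
  apply: ge0_le_integral => //.
  - by move=> w _; rewrite lee_fin powR_ge0.
  - apply/measurable_EFinP; apply: (measurableT_comp (measurable_powR p)).
    apply: measurable_funD => //; apply: measurable_hsnorm_sqr => i.
    exact: (measurable_tem xi Phi Phiinv mu htau hF hW H1 H3 N0).
  - apply: (measurableT_comp mH); exact: measurable_fun_pair.
  move=> w _; rewrite lee_fin ge0_ler_powR ?nnegrE ?addr_ge0 ?sqr_ge0 ?(ltW p0)//.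
  rewrite lerD2l lerXn2r ?nnegrE ?hsnorm_ge0//.
  by have [+ _] := truncation_le tau xi hPhiP hmu0 (y (X w, Y w)) D0 D1; apply.
rewrite (ge0_integral_indep XY mH H0).
apply: ge0_le_integral => //.
- by move=> w _; apply: integral_ge0.
- exact: (measurableT_comp (measurable_integral_indep P Y mH H0) mid).
move=> w _; apply: le_trans (hrhs w).
have sD : Num.sqrt D ^+ 2 = D by rewrite sqr_sqrtr// ltW.
have s0 : 0 < Num.sqrt D by rewrite sqrtr_gt0.
have s1 : Num.sqrt D <= 1 by rewrite -[leRHS]sqrtr1 ler_wsqrtr.
have [hf hg] := scaled_growth n w.
have := hC s0 s1 nuE hf hg.
by rewrite sD.
Qed.

End EnergyStep.

End Scheme.

(** * Moment bound *)

Section BoundedExpectation.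
Context {R : realType} {disp : measure_display} {Omega : measurableType disp}.
Variable P : probability Omega R.

Definition bounded_rv (X : Omega -> R) :=
  measurable_fun setT X /\ exists B, forall w, `|X w| <= B.

Local Notation "'mean' X" := (\int[P]_w X w)%R (at level 10, X at level 8).

Lemma bounded_rv_integrable X : bounded_rv X -> P.-integrable setT (EFin \o X).
Proof.
move=> [mX [B hB]]; apply: measurable_bounded_integrable => //.
  by rewrite -ge0_fin_numE ?fin_num_measure.
exists B; split; first exact: num_real.
by move=> M BM w _; exact: le_trans (hB w) (ltW BM).
Qed.

Lemma bounded_rv_cst c : bounded_rv (fun=> c).
Proof. by split; [exact: measurable_cst|exists `|c|]. Qed.

Lemma bounded_rvD X Y : bounded_rv X -> bounded_rv Y ->
  bounded_rv (fun w => X w + Y w).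
Proof.
move=> [mX [A hA]] [mY [B hB]]; split; first exact: measurable_funD.
by exists (A + B) => w; rewrite (le_trans (ler_normD _ _))// lerD.
Qed.

Lemma bounded_rvZ c X : bounded_rv X -> bounded_rv (fun w => c * X w).
Proof.
move=> [mX [A hA]]; split; first exact: measurable_funM.
by exists (`|c| * A) => w; rewrite normrM ler_wpM2l.
Qed.

Lemma mean_cst (c : R) : (\int[P]_w c)%R = c.
Proof. by rewrite /Rintegral integral_cst_prob. Qed.

Lemma meanD X Y : bounded_rv X -> bounded_rv Y ->
  (\int[P]_w (X w + Y w))%R = mean X + mean Y.
Proof. by move=> hX hY; rewrite RintegralD//; exact: bounded_rv_integrable. Qed.

Lemma meanZ c X : bounded_rv X -> (\int[P]_w (c * X w))%R = c * mean X.
Proof. by move=> hX; rewrite RintegralZl//; exact: bounded_rv_integrable. Qed.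

Lemma mean_mono X Y : bounded_rv X -> bounded_rv Y -> (forall w, X w <= Y w) ->
  mean X <= mean Y.
Proof. by move=> hX hY XY; apply: le_Rintegral => //; exact: bounded_rv_integrable. Qed.

Lemma meanE X : bounded_rv X -> (\int[P]_w (X w)%:E)%E = (mean X)%:E.
Proof.
move=> hX; rewrite /Rintegral fineK//.
by apply: integrable_fin_num => //; exact: bounded_rv_integrable.
Qed.

End BoundedExpectation.

(** In the application [e] is the left-hand side of the Khasminskii condition, [k]
    the factor of [K1] times [K1], and [Y], [Y'] are the present and the delayed
    energy. *)
Lemma drift_arith (R : realType) (D p C K1 K2 Y Y' V V' e k : R) :
  D * p * e <= D * p * (k - K2 * (V - V')) ->
  D * p * k <= D * p * (K1 * (1 + Y + Y')) ->
  0 <= C * D * Y' -> 0 <= C * D ->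
  Y + D * p * e + C * D * Y <=
  (1 + D * (p * K1 + C)) * Y + D * (p * K1 + C) * Y' + D * (p * K1 + C) +
  (D * p * (K2 * V') + - (D * p) * (K2 * V)).
Proof. lra. Qed.

Section Recursion.
Context {R : realType} {d m : nat} {disp : measure_display} {Omega : measurableType disp}.
Variables (tau : R) (f : 'cV[R]_d -> 'cV[R]_d -> 'cV[R]_d)
  (g : 'cV[R]_d -> 'cV[R]_d -> 'M[R]_(d, m)) (P : probability Omega R)
  (F : R -> set (set Omega)) (W : R -> Omega -> 'cV[R]_m)
  (xi : R -> 'cV[R]_d) (Phi Phiinv : R -> R) (mu : R).
Hypotheses (htau : 0 < tau) (hF : filtration F) (hW : brownian_motion P F W)
  (hxi : {within `[- tau, 0], continuous xi})
  (hPhiP : truncation_function f g Phi Phiinv)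
  (hmu0 : 0 < mu) (hmu : mu <= 1 / 2)
  (H1 : local_lipschitz1 f g) (H3 : locally_uniformly_continuous2 f g).
Let L0 := Num.max (supnorm tau xi) 1.

Variables (q K1 K2 C B0 : R) (V1 : 'cV[R]_d -> R).
Hypotheses (q0 : 0 < q) (K10 : 0 <= K1) (K20 : 0 <= K2) (C0 : 0 <= C)
  (Vcont : continuous V1) (V0 : forall x, 0 <= V1 x).
Hypothesis H2 : forall x y : 'cV[R]_d,
  (1 + hsnorm x ^+ 2) `^ (q / 2 - 1) *
    (dotv (2 *: x) (f x y) + Num.max (q - 1) 1 * hsnorm (g x y) ^+ 2)
  <= K1 * (1 + hsnorm x `^ q + hsnorm y `^ q) - K2 * (V1 x - V1 y).
Hypothesis hC : one_step_bound m (q / 2) (Phi L0) C.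
Hypothesis hB0 : forall x, hsnorm x <= L0 -> K2 * V1 x <= B0.

Let c1 := q / 2 * K1 + C.
Let S0 := 1 + (1 + L0 ^+ 2) `^ (q / 2) + tau * (q / 2) * B0.

Lemma tem_segment_shift N (w : R -> 'cV[R]_m) n k :
  tem_segment f g tau xi Phi Phiinv mu N w (n + k) k =
  tem_segment f g tau xi Phi Phiinv mu N w n 0.
Proof. by elim: k => [|k IH]; rewrite ?addn0// addnS. Qed.

Lemma tem_segment_past N (w : R -> 'cV[R]_m) n k : (n <= k)%N ->
  tem_segment f g tau xi Phi Phiinv mu N w n k = xi (- ((k - n)%:R * stepsize tau N)).
Proof.
elim: n k => [|n IH] k; first by rewrite subn0.
by case: k => // k nk; rewrite /= IH// subSS.
Qed.

(** The states are indexed with a delay: [z k] is the state at time [k - N], so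
    that the initial segment corresponds to [k <= N] and the recursion has the form
    required by [discrete_gronwall]. *)
Lemma tem_moment_le N n : (0 < N)%N -> stepsize tau N <= 1 ->
  (\int[P]_w (hsnorm (tem_segment f g tau xi Phi Phiinv mu N (fun t => W t w) n 0) `^ q)%:E
    <= (S0 * (1 + 3 * (stepsize tau N * c1)) ^+ n)%:E)%E.
Proof.
move=> N0 D1; set D := stepsize tau N.
have D0 : 0 < D := stepsize_gt0 htau N0.
have p0 : 0 < q / 2 by rewrite divr_gt0.
have c10 : 0 <= c1 by rewrite addr_ge0// mulr_ge0// ltW.
have L01 : 1 <= L0 by rewrite le_max lexx orbT.
have [rho Lr [Pr er]] := truncation_level tau xi hPhiP hmu0 D0 D1.
have r1 : 1 <= rho by exact: le_trans Lr.
have [Br hBr] := lyapunov_bounded q0 K10 hPhiP r1 H2.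
pose z k w := tem_segment f g tau xi Phi Phiinv mu N (fun t => W t w) k N.
pose u k w := (1 + hsnorm (z k w) ^+ 2) `^ (q / 2).
pose v k w := K2 * V1 (z k w).
have zr k w : hsnorm (z k w) <= rho.
  exact: (tem_le W htau hxi hPhiP hmu0 N0 D1 k w Lr er (leqnn N)).
have mz k i : measurable_fun setT (fun w => z k w i 0).
  exact: (measurable_tem xi Phi Phiinv mu htau hF hW H1 H3 N0).
have u0 k w : 0 <= u k w by exact: powR_ge0.
have v0 k w : 0 <= v k w by rewrite mulr_ge0.
have hu k : bounded_rv (u k).
  split.
    apply: (measurableT_comp (measurable_powR (q / 2))).
    by apply: measurable_funD => //; exact: measurable_hsnorm_sqr.
  exists ((1 + rho ^+ 2) `^ (q / 2)) => w; rewrite ger0_norm//.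
  rewrite ge0_ler_powR ?nnegrE ?addr_ge0 ?sqr_ge0 ?(ltW p0)//.
  by rewrite lerD2l lerXn2r ?nnegrE ?hsnorm_ge0// (le_trans _ r1).
have hv k : bounded_rv (v k).
  split; last by exists Br => w; rewrite ger0_norm// hBr.
  apply: measurable_funM => //.
  apply: (measurable_fun_cont2 (X := z k) (Y := z k) (phi := fun x _ => V1 x)) => // x y x_ y_ hx _.
  by apply: (cvg_comp _ _ (cV_cvg_rate hx)); exact: Vcont.
pose a k := (\int[P]_w u k w)%R.
pose b k := (\int[P]_w v k w)%R.
have b0 k : 0 <= b k.
  by rewrite -(mean_cst P 0); apply: mean_mono => //; exact: bounded_rv_cst.
have zpast k w : (k <= N)%N -> hsnorm (z k w) <= L0.
  move=> kN; rewrite /z tem_segment_past//.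
  exact: (xi_node_le htau hxi N0 (leq_subr k N)).
have a_init k : (k <= N)%N -> a k <= (1 + L0 ^+ 2) `^ (q / 2).
  move=> kN; rewrite -[leRHS](mean_cst P); apply: mean_mono => //.
    exact: bounded_rv_cst.
  move=> w; rewrite ge0_ler_powR ?nnegrE ?addr_ge0 ?sqr_ge0 ?(ltW p0)//.
  by rewrite lerD2l lerXn2r ?nnegrE ?hsnorm_ge0// ?zpast// (le_trans _ L01).
have b_init k : (k <= N)%N -> b k <= B0.
  move=> kN; rewrite -[leRHS](mean_cst P); apply: mean_mono => //.
    exact: bounded_rv_cst.
  by move=> w; apply: hB0; exact: zpast.
have B00 : 0 <= B0 by exact: le_trans (b0 0%N) (b_init _ (leq0n _)).
have Lp : 0 <= (1 + L0 ^+ 2) `^ (q / 2) by exact: powR_ge0.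
have tB0 : 0 <= tau * (q / 2) * B0 by exact: mulr_ge0 (mulr_ge0 (ltW htau) (ltW p0)) B00.
have zE k w : z (k + N)%N w = tem_segment f g tau xi Phi Phiinv mu N (fun t => W t w) k 0.
  exact: tem_segment_shift.
have zSE k w : z (k + N).+1 w = tem_segment f g tau xi Phi Phiinv mu N (fun t => W t w) k.+1 0.
  by rewrite -addSn zE.
have Dp0 : 0 <= D * (q / 2) by rewrite mulr_ge0 ?(ltW D0) ?(ltW p0).
have rec k : a (k + N).+1 + D * (q / 2) * b (k + N)%N <=
     (1 + D * c1) * a (k + N)%N + D * c1 * a k + D * c1 + D * (q / 2) * b k.
  pose r w := (1 + D * c1) * u (k + N)%N w + D * c1 * u k w + D * c1 +
     (D * (q / 2) * v k w + - (D * (q / 2)) * v (k + N)%N w).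
  have h1 := bounded_rvZ (1 + D * c1) (hu (k + N)%N).
  have h2 := bounded_rvZ (D * c1) (hu k).
  have h3 : bounded_rv (fun _ : Omega => D * c1) by exact: bounded_rv_cst.
  have h4 := bounded_rvZ (D * (q / 2)) (hv k).
  have h5 := bounded_rvZ (- (D * (q / 2))) (hv (k + N)%N).
  have hr : bounded_rv r.
    exact: (bounded_rvD (bounded_rvD (bounded_rvD h1 h2) h3) (bounded_rvD h4 h5)).
  have Er : (\int[P]_w r w)%R = (1 + D * c1) * a (k + N)%N + D * c1 * a k + D * c1 +
     (D * (q / 2) * b k + - (D * (q / 2)) * b (k + N)%N).
    rewrite /r (meanD P (bounded_rvD (bounded_rvD h1 h2) h3) (bounded_rvD h4 h5)).
    rewrite (meanD P (bounded_rvD h1 h2) h3) (meanD P h1 h2) (meanD P h4 h5).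
    by rewrite mean_cst (meanZ P _ (hu k)) (meanZ P _ (hu _)) (meanZ P _ (hv k)) (meanZ P _ (hv _)).
  suff : a (k + N).+1 <= (\int[P]_w r w)%R by rewrite Er addrA mulNr lerBrDr.
  rewrite -lee_fin -!meanE//.
  under eq_integral do rewrite /u zSE.
  apply: (conditional_step htau hF hW hxi hPhiP hmu0 hmu H1 H3 N0 D1 p0 hC
    (n := k) (rhs := fun w => (r w)%:E)).
    by apply/measurable_EFinP; have [] := hr.
  move=> w; rewrite lee_fin -zE.
  rewrite -/(z k w) -/(u (k + N)%N w).
  have -> : 2 * (q / 2) - 1 = q - 1 by field.
  set y := z (k + N)%N w; set y' := z k w.
  have hy := H2 y y'.
  have hyu : hsnorm y `^ q <= u (k + N)%N w by exact: hsnorm_powR_le (ltW q0).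
  have hyu' : hsnorm y' `^ q <= u k w by exact: hsnorm_powR_le (ltW q0).
  have h6 := ler_wpM2l Dp0 hy.
  have h7 : D * (q / 2) * (K1 * (1 + hsnorm y `^ q + hsnorm y' `^ q)) <=
            D * (q / 2) * (K1 * (1 + u (k + N)%N w + u k w)).
    by rewrite ler_wpM2l// ler_wpM2l// lerD// lerD2l.
  have h8 : 0 <= C * D * u k w by exact: mulr_ge0 (mulr_ge0 C0 (ltW D0)) (u0 _ _).
  have h9 : 0 <= C * D by exact: mulr_ge0 C0 (ltW D0).
  exact: drift_arith h6 h7 h8 h9.
have S1 : 1 <= S0 by rewrite /S0 -addrA lerDl addr_ge0.
have tauE : N%:R * D = tau.
  by rewrite /D /stepsize mulrCA divff ?mulr1// pnatr_eq0 -lt0n.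
have hS : a N + D * (q / 2) * (\sum_(k < N) b k) <= S0.
  have hs : \sum_(k < N) b k <= N%:R * B0.
    apply: (@le_trans _ _ (\sum_(k < N) B0)).
      by apply: ler_sum => k _; apply: b_init; exact: ltnW.
    by rewrite sumr_const card_ord mulr_natl.
  have := ler_wpM2l Dp0 hs.
  have -> : D * (q / 2) * (N%:R * B0) = (N%:R * D) * (q / 2) * B0 by ring.
  rewrite tauE; have := a_init N (leqnn N); rewrite /S0; lra.
have ainit k : (k <= N)%N -> a k <= S0.
  move=> kN; apply: le_trans (a_init k kN) _.
  by rewrite /S0 addrAC lerDr addr_ge0.
have hg := discrete_gronwall (ltW D0) (ltW p0) c10 S1 b0 ainit hS rec n.
apply: (@le_trans _ _ (a (n + N)%N)%:E); last by rewrite lee_fin.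
rewrite -meanE//; apply: ge0_le_integral => //.
- by move=> w _; rewrite lee_fin powR_ge0.
- apply/measurable_EFinP; apply: (measurableT_comp (measurable_powR q)).
  apply: measurable_fun_hsnorm => i.
  exact: (measurable_tem xi Phi Phiinv mu htau hF hW H1 H3 N0).
- by apply/measurable_EFinP; have [] := hu (n + N)%N.
- by move=> w _; rewrite lee_fin /u zE; exact: hsnorm_powR_le (ltW q0).
Qed.

End Recursion.

Theorem theorem3p1 (R : realType) (d m : nat) (hd : (0 < d)%N) (hm : (0 < m)%N)
  (tau : R) (htau : 0 < tau)
  (f : 'cV[R]_d -> 'cV[R]_d -> 'cV[R]_d)
  (g : 'cV[R]_d -> 'cV[R]_d -> 'M[R]_(d, m))
  (disp : measure_display) (Omega : measurableType disp)
  (P : probability Omega R)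
  (F : R -> set (set Omega)) (hF : filtration F) (hFu : usual_conditions P F)
  (W : R -> Omega -> 'cV[R]_m) (hW : brownian_motion P F W)
  (xi : R -> 'cV[R]_d) (hxi : {within `[- tau, 0], continuous xi})
  (Phi Phiinv : R -> R) (hPhiP : truncation_function f g Phi Phiinv)
  (mu : R) (hmu0 : 0 < mu) (hmu : mu <= 1 / 2)
  (q : R) (H1 : local_lipschitz1 f g) (H2 : khasminskii f g q) (H3 : locally_uniformly_continuous2 f g) :
  forall T : R, 0 < T -> exists2 C : R, 0 < C &
    (ereal_sup
      [set ereal_sup
        [set 'E_P[fun w : Omega =>
                    (hsnorm (tem f g tau xi Phi Phiinv mu N (fun t => W t w) i)
                      `^ q)%R]
        | i in [set i : int | (0 <= i%:~R * stepsize tau N <= T)%R]]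
      | N in [set N : nat | (0 < N)%N /\ (stepsize tau N <= 1)%R]]
    <= C%:E)%E.
Proof.
move=> T T0; have [q0 [K1 [K2 [V1 [K10 K20 Vcont V0 HV]]]]] := H2.
set L0 := Num.max (supnorm tau xi) 1.
have L01 : 1 <= L0 by rewrite le_max lexx orbT.
have K0 : 0 <= Phi L0 by have [[P0 _ _ _ _] _] := hPhiP; exact: P0.
have p0 : 0 < q / 2 by rewrite divr_gt0.
have [C C0 hC] := one_step m p0 K0.
have [B hB] := lyapunov_bounded q0 K10 hPhiP L01 HV.
have B0 : 0 <= B.
  apply: le_trans (hB 0 _); first by rewrite mulr_ge0.
  have -> : hsnorm (0 : 'cV[R]_d) = 0 by rewrite -(scale0r (0 : 'cV[R]_d)) hsnormZ normr0 mul0r.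
  lra.
pose c1 := q / 2 * K1 + C.
have c10 : 0 <= c1 by rewrite addr_ge0// mulr_ge0// ltW.
pose S0 := 1 + (1 + L0 ^+ 2) `^ (q / 2) + tau * (q / 2) * B.
have S1 : 0 < S0.
  have := powR_ge0 (1 + L0 ^+ 2) (q / 2).
  have : 0 <= tau * (q / 2) * B by exact: mulr_ge0 (mulr_ge0 (ltW htau) (ltW p0)) B0.
  rewrite /S0; lra.
exists (S0 * expR (3 * c1 * T)); first by rewrite mulr_gt0// expR_gt0.
apply: ge_ereal_sup => _ [N [N0 D1] <-]; apply: ge_ereal_sup => _ [i /andP[i0 iT] <-].
have D0 := stepsize_gt0 htau N0.
case: i i0 iT => [n _ nT|n i0 _]; last first.
  by move: i0; rewrite pmulr_lge0// ler0z.
rewrite unlock.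
apply: (le_trans (tem_moment_le htau hF hW hxi hPhiP hmu0 hmu H1 H3 q0 K10 K20 C0
  Vcont V0 HV hC hB n N0 D1)).
rewrite lee_fin -/L0 -/c1 -/S0 ler_wpM2l ?(ltW S1)//.
apply: (@le_trans _ _ (expR (3 * (stepsize tau N * c1)) ^+ n)).
  rewrite lerXn2r ?nnegrE ?expR_ge0 ?expR_ge1Dx//.
  by rewrite addr_ge0// mulr_ge0// mulr_ge0// ltW.
rewrite -expRM_natl ler_expR.
have -> : n%:R * (3 * (stepsize tau N * c1)) = 3 * c1 * (n%:R * stepsize tau N) by ring.
by rewrite ler_wpM2l// mulr_ge0.
Qed.
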